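(* For every integer $n\ge 6$, $R(C_n,W_7)=2n-1$.
   Context: All graphs are finite and simple. $C_m$ is the cycle on $m$ vertices. $W_s=K_1+C_{s-1}$ denotes the wheel on $s$ vertices, i.e. the graph obtained from the cycle $C_{s-1}$ by adding one new vertex (the hub) adjacent to all vertices of the cycle; thus $W_7=K_1+C_6$. For graphs $F$ and $J$, $R(F,J)$ is the least integer $N$ such that every red--blue coloring of the edges of $K_N$ contains a red copy of $F$ or a blue copy of $J$; copies are subgraphs that need not be induced. *)

(* Defs.v *)
From HB Require Import structures.
From mathcomp Require Import all_boot.
Set Implicit Arguments. Unset Strict Implicit. Unset Printing Implicit Defensive.

Record sgraph := SGraph {
  vertex :> finType;
  adj : rel vertex;
  adj_sym : symmetric adj;
  adj_irrefl : irreflexive adj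
}.

Section Complete.
Variable n : nat.
Definition complete_adj (x y : 'I_n) := x != y.
Lemma complete_sym : symmetric complete_adj.
Proof. by move=> x y; rewrite /complete_adj eq_sym. Qed.
Lemma complete_irrefl : irreflexive complete_adj.
Proof. by move=> x; rewrite /complete_adj eqxx. Qed.
Definition complete_graph := SGraph complete_sym complete_irrefl.
End Complete.

(* This is the cycle C_n for n >= 3; the condition x != y only matters for
   n = 1, where it excludes a loop. *)
Section Cycle.
Variable n : nat.
Definition cycle_adj (x y : 'I_n) :=
  (x != y) && ((y == ordS x) || (x == ordS y)).
Lemma cycle_sym : symmetric cycle_adj.
Proof. by move=> x y; rewrite /cycle_adj eq_sym orbC. Qed.
Lemma cycle_irrefl : irreflexive cycle_adj.
Proof. by move=> x; rewrite /cycle_adj eqxx. Qed.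
Definition cycle_graph := SGraph cycle_sym cycle_irrefl.
End Cycle.

(* The join F + J: the disjoint union together with all edges between the two
   parts. *)
Section Join.
Variables F J : sgraph.
Definition join_adj (x y : F + J) :=
  match x, y with
  | inl u, inl v => adj u v
  | inr u, inr v => adj u v
  | _, _ => true
  end.
Lemma join_sym : symmetric join_adj.
Proof. by move=> [u|u] [v|v] //=; exact: adj_sym. Qed.
Lemma join_irrefl : irreflexive join_adj.
Proof. by move=> [u|u] /=; exact: adj_irrefl. Qed.
Definition join_graph := SGraph join_sym join_irrefl.
End Join.

(* W_s has s vertices in total, hub included. *)
Definition wheel_graph (s : nat) :=
  join_graph (complete_graph 1) (cycle_graph s.-1).

(* A two-coloring of the edges of K_N assigns to each pair {x, y} of distinct
   vertices the color c [set x; y], true being red and false being blue; the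
   values of c on the other sets are never used. *)
Section ColorClass.
Variables (N : nat) (c : {set 'I_N} -> bool) (b : bool).
Definition color_adj (x y : 'I_N) := (x != y) && (c [set x; y] == b).
Lemma color_sym : symmetric color_adj.
Proof. by move=> x y; rewrite /color_adj eq_sym setUC. Qed.
Lemma color_irrefl : irreflexive color_adj.
Proof. by move=> x; rewrite /color_adj eqxx. Qed.
Definition color_class := SGraph color_sym color_irrefl.
End ColorClass.

Definition red_graph N (c : {set 'I_N} -> bool) := color_class c true.
Definition blue_graph N (c : {set 'I_N} -> bool) := color_class c false.

Definition contains_copy (G F : sgraph) :=
  exists f : F -> G, injective f /\ forall x y : F, adj x y -> adj (f x) (f y).

Definition arrows (N : nat) (F J : sgraph) :=
  forall c : {set 'I_N} -> bool,
    contains_copy (red_graph c) F \/ contains_copy (blue_graph c) J.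

(* R(F, J) = N *)
Definition is_ramsey_number (F J : sgraph) (N : nat) :=
  arrows N F J /\ forall M : nat, arrows M F J -> N <= M.

(* Main.v *)
Require Import Defs.
From mathcomp Require Import all_boot zify.
From Stdlib Require Import NArith.
Set Implicit Arguments. Unset Strict Implicit. Unset Printing Implicit Defensive.

(** Lower bound.  Split at most 2n-2 vertices into two parts with at most n-1
    vertices each; colour red the pairs inside a part and blue the pairs across.
    A red cycle lives in one part, so it has fewer than n vertices; blue is
    bipartite, so it has no triangle, and a wheel has one ([no_red_cycle],
    [no_blue_wheel]).

    Upper bound.  Suppose that 2n-1 vertices are coloured with no red C_n and
    no blue wheel with a rim of length six.  The proof is by induction on n.

    - For n = 6 and n = 7 all colourings are generated, one vertex at a time and
      up to relabelling, until none is left ([ramsey6], [ramsey7]).  For n = 7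
      the generation starts from a red C_6, which the case n = 6 provides.

    - For n = m+1 with m >= 7, the induction provides a red cycle c of length m;
      there are m+1 vertices off it.

    First, a vertex x off the cycle has at most two red neighbours on it
    ([few_neighbours]).  If c_i, c_j, c_l are red neighbours of x, rerouting the
    cycle shows that x, c_(i+1), c_(j+1), c_(l+1) form a blue clique Q and that a
    further vertex with a red neighbour in Q (an attached vertex) is blue to
    c_(i+2), c_(j+2), c_(l+2).  As there is no blue wheel, the attached vertices
    have at most two blue neighbours among themselves, and at most two vertices
    are not attached.  Hence the red graph on the attached vertices is very dense:
    if it has at least seven vertices, any two of them are joined by red paths of
    all lengths from five vertices on ([panconnected]).  If adjacent attached
    vertices see different vertices of Q, such a path (for small m, a short
    explicit one) and a path inside the cycle and x together close a red C_(m+1).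
    Otherwise all attached vertices see a single vertex q0 of Q; then a red path
    through all m vertices off the cycle other than x closes a red C_(m+1) at q0
    ([attachment_absurd]).

    Secondly, by the theorem of Dirac ([dirac]) some h off the cycle has at least
    four blue neighbours off the cycle, for otherwise the m+1 vertices off the cycle
    carry a red C_(m+1).  If m >= 8, three of them, y1, y2, y3, can be interlaced
    with three vertices of the cycle that are blue to h and to the two
    neighbouring y's, because h, y1, y2, y3 have few red neighbours on the cycle:
    this is the rim of a blue wheel with hub h ([long_fan_absurd]).  If m = 7 the
    cycle may be too short for that; four blue neighbours of h and all possible
    red neighbourhoods on the cycle are then checked by evaluation
    ([all_sparse_settled]). *)

(** * Colourings with no red cycle and no blue wheel *)

Section Coloring.
Variables (V : finType) (red : rel V).
Definition blue : rel V := fun x y => (x != y) && ~~ red x y.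
Definition no_cycle n := forall s : seq V, size s = n -> uniq s -> ~ cycle red s.
Definition no_wheel := forall h (s : seq V),
  size s = 6 -> uniq s -> all (blue h) s -> ~ cycle blue s.
End Coloring.

(** * Exhaustive generation of small colourings *)

(** Vertices are numbered from 0, sets of vertices are given by their
    characteristic vectors, and a graph is the list of its neighbourhoods.  The
    functions below are evaluated on thousands of graphs by call by value: they
    are structural recursions on short lists, and nested conditionals stand
    for the boolean connectives so that a test stops at the first answer. *)
Definition mask := seq bool.
Definition graph := seq mask.

Fixpoint or_and (acc u v : mask) : mask := match acc, u, v with
  | a :: acc', x :: u', y :: v' =>
    (if a then true else if x then y else false) :: or_and acc' u' v'
  | _, _, _ => [::] end.

Fixpoint covers (acc u : mask) : bool := match acc, u with
  | a :: acc', x :: u' =>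
    if (if x then a else true) then covers acc' u' else false
  | _, _ => true end.

Fixpoint meets (u v : mask) : bool := match u, v with
  | x :: u', y :: v' => if (if x then y else false) then true else meets u' v'
  | _, _ => false end.

Definition clear i (u : mask) : mask := set_nth false u i false.

Fixpoint fold_nbrs (f : nat -> mask -> mask -> mask) i (g : graph)
    (u av acc : mask) : mask := match g, u, av with
  | r :: g', x :: u', y :: av' =>
    fold_nbrs f i.+1 g' u' av' (if (if x then y else false) then f i r acc else acc)
  | _, _, _ => acc end.

(** The search for paths: adds to [acc] the last vertices of the paths with
    [d + 2] vertices that start in [u] and stay in [av].  A branch is cut as soon as
    [acc] contains all of [av], since it can bring nothing new. *)
Fixpoint ends (g : graph) d (u av acc : mask) : mask := match d with
  | 0 => fold_nbrs (fun _ r acc => or_and acc r av) 0 g u av acc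
  | d'.+1 => if covers acc av then acc else
      fold_nbrs (fun i r acc => ends g d' r (clear i av) acc) 0 g u av acc
  end.

Definition edge (g : graph) i j := nth false (nth [::] g i) j.

Fixpoint mapi (A B : Type) (f : nat -> A -> B) i (s : seq A) : seq B :=
  match s with [::] => [::] | x :: s' => f i x :: mapi f i.+1 s' end.

Definition complement (g : graph) : graph :=
  mapi (fun i r => clear i (map negb r)) 0 g.

(** Row [i] marks the [j < i] that are joined to [i] by a red path with
    [n - 1] vertices: a vertex red to both closes a red cycle of length [n].
    By symmetry the [j >= i] need no search, so they are marked from the start,
    which lets [ends] stop early. *)
Definition red_ends n (g : graph) : graph :=
  let k := size g in
  mapi (fun i r => ends g (n - 4) r (clear i (nseq k true)) (mkseq (leq i) k)) 0 g.

(** The entry for a hub [h] and a blue neighbour [a] of [h] marks the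
    [b > a] that are joined to [a] by a blue path with five vertices inside the
    blue neighbourhood of [h]: a vertex blue to [h], [a] and [b] completes a blue
    wheel with hub [h]. *)
Definition hub_ends (b : graph) : seq graph :=
  let k := size b in
  [seq mapi (fun a r => if nth false m a
                        then ends b 2 r (clear a m) (mkseq (geq a) k)
                        else [::]) 0 b | m <- b].

Definition hub_triple (he : seq graph) i j k :=
  [|| edge (nth [::] he i) k j, edge (nth [::] he j) k i
    | edge (nth [::] he k) j i].

(** The triples of vertices that a new vertex cannot all be blue to, indexed
    by decreasing vertices so that the entry for [i] concerns only [j, k < i]. *)
Definition hub_triples (he : seq graph) : seq (seq mask) :=
  mkseq (fun i => mkseq (fun j => mkseq (hub_triple he i j) j) i) (size he).

Fixpoint clash (x : bool) (p q : mask) : bool := match p, q with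
  | a :: p', b :: q' => if (if b then a == x else false) then true else clash x p' q'
  | _, _ => false end.

Fixpoint clash2 (p ps : mask) (t : seq mask) : bool := match ps, t with
  | a :: ps', r :: t' =>
    if (if a then false else clash false p r) then true else clash2 p ps' t'
  | _, _ => false end.

(** Builds the possible red neighbourhoods of a new vertex one vertex at a time
    and drops a partial choice once it closes a red cycle or a blue wheel with the
    new vertex on the rim. *)
Fixpoint rows (re : graph) (tr : seq (seq mask)) (ps : seq mask) : seq mask :=
  match re, tr with
  | e :: re', t :: tr' => rows re' tr' (flatten
      [seq (if clash true p e then [::] else [:: rcons p true]) ++
           (if clash2 p p t then [::] else [:: rcons p false]) | p <- ps])
  | _, _ => ps end.

(** Looks in [m] for a cycle with [d + 3] vertices, through each vertex in turn;
    a vertex that has been tried is removed. *)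
Fixpoint cycle_in d (b : graph) (i : nat) (rs : graph) (ms m : mask) : bool :=
  match rs, ms with
  | r :: rs', x :: ms' =>
    let m' := clear i m in
    if (if x then meets r (ends b d r m' (nseq (size b) false)) else false)
    then true else cycle_in d b i.+1 rs' ms' m'
  | _, _ => false end.
Definition has_cycle_in d (b : graph) (m : mask) := cycle_in d b 0 b m m.

(** The filter excludes the blue wheels that have the new vertex as their hub. *)
Definition new_rows n (g : graph) : seq mask :=
  let b := complement g in
  [seq s <- rows (red_ends n g) (hub_triples (hub_ends b)) [:: [::]]
     | ~~ has_cycle_in 3 b (map negb s)].

Fixpoint add_column (g : graph) (s : mask) : graph := match g, s with
  | r :: g', x :: s' => rcons r x :: add_column g' s' | _, _ => [::] end.
Definition add_vertex g s : graph := rcons (add_column g s) (rcons s false).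

Definition degree (r : mask) : N :=
  foldl (fun a (x : bool) => if x then N.succ a else a) N0 r.
Fixpoint weight (r : mask) (k : seq N) (a : N) : N := match r, k with
  | x :: r', c :: k' => weight r' k' (if x then N.add a c else a) | _, _ => a end.
Definition refine (g : graph) (k : seq N) : seq N :=
  let k2 := [seq N.mul c c | c <- k] in
  [seq N.add (N.mul 16 (weight r k2 N0)) (degree r) | r <- g].
(** Sorting the vertices by an iterated degree gives many isomorphic graphs the
    same matrix.  It is far from a canonical form, but it removes enough copies to
    keep the levels of the generation small, and being a permutation is
    all that its correctness rests on. *)
Definition order (g : graph) : seq nat :=
  let k := refine g (refine g (map degree g)) in
  map snd (sort (fun a b => N.leb a.1 b.1) (zip k (iota 0 (size g)))).
Definition relabel (g : graph) (o : seq nat) : graph :=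
  [seq let r := nth [::] g i in [seq nth false r j | j <- o] | i <- o].
Definition normalize g := relabel g (order g).

Fixpoint mask_cmp (u v : mask) : comparison := match u, v with
  | x :: u', y :: v' =>
    if x then (if y then mask_cmp u' v' else Gt) else (if y then Lt else mask_cmp u' v')
  | _, _ => Eq end.
Fixpoint graph_cmp (u v : graph) : comparison := match u, v with
  | x :: u', y :: v' =>
    match mask_cmp x y with Eq => graph_cmp u' v' | c => c end
  | _, _ => Eq end.
Definition graph_le u v := if graph_cmp u v is Gt then false else true.
Fixpoint dedup (l : seq graph) : seq graph := match l with
  | x :: ((y :: _) as l') => if x == y then dedup l' else x :: dedup l'
  | _ => l end.
Definition collect (l : seq graph) := dedup (sort graph_le (map normalize l)).
Definition next_level n (l : seq graph) : seq graph :=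
  collect (flatten [seq [seq add_vertex g s | s <- new_rows n g] | g <- l]).

(** * Correctness of the searches for paths and cycles *)

Lemma size_mapi A B (f : nat -> A -> B) i s : size (mapi f i s) = size s.
Proof. by elim: s i => //= x s IH i; rewrite IH. Qed.

Lemma nth_mapi A B (f : nat -> A -> B) x y i s j :
  j < size s -> nth y (mapi f i s) j = f (i + j) (nth x s j).
Proof.
elim: s i j => // z s IH i [|j] ltj /=; first by rewrite addn0.
by rewrite IH // addSnnS.
Qed.

Lemma nth_clear i u j : nth false (clear i u) j = (j != i) && nth false u j.
Proof. by rewrite /clear nth_set_nth /=; case: eqP. Qed.

Lemma size_clear i u : i < size u -> size (clear i u) = size u.
Proof. by move=> lti; rewrite /clear size_set_nth; apply/maxn_idPr. Qed.

Lemma nth_true u j : nth false u j -> j < size u.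
Proof. by apply: contraTT; rewrite -leqNgt => /(nth_default false) ->. Qed.

Lemma or_andP acc u v b : nth false (or_and acc u v) b ->
  nth false acc b \/ nth false u b /\ nth false v b.
Proof.
elim: acc u v b => [|a acc IH] [|x u] [|y v] [|b] //=; try by move/nth_true.
- by case: a; [left | case: x; [right|]].
- exact: IH.
Qed.

Lemma fold_nbrs_ind (P : mask -> Prop) f i g u av acc :
    P acc ->
    (forall w acc', nth false u w -> nth false av w -> P acc' ->
       P (f (i + w) (nth [::] g w) acc')) ->
  P (fold_nbrs f i g u av acc).
Proof.
elim: g i u av acc => [|r g IH] i [|x u] [|y av] acc //= Pacc Pf.
apply: IH => [|w acc' uw aw Pw]; last by rewrite addSnnS; apply: (Pf w.+1).
case: x y Pf => [] [] // Pf.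
by have := Pf 0 acc isT isT Pacc; rewrite addn0.
Qed.

Lemma endsP g d u av acc b : (forall i, ~~ edge g i i) ->
  nth false (ends g d u av acc) b -> nth false acc b \/
  exists a q, [/\ size q = d.+1, uniq (a :: q), all (nth false av) (a :: q),
                  nth false u a & path (edge g) a q /\ last a q = b].
Proof.
move=> irr; elim: d u av acc b => [|d IH] u av acc b; rewrite [ends _ _ _ _ _]/=.
  apply: (fold_nbrs_ind (P := fun m => nth false m b -> _)) => [|w m uw aw IHm]; first by left.
  move=> /or_andP [/IHm //|[wb ab]]; right; exists w, [:: b].
  split=> //=; rewrite ?uw ?aw ?ab //= ?andbT ?inE; last by [].
  by apply: contraNneq (irr w) => {2}->.
case: ifP => _; first by left.
apply: (fold_nbrs_ind (P := fun m => nth false m b -> _)) => [|w m uw aw IHm]; first by left.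
rewrite add0n => /IH [/IHm //|[a [q [sq uq aq wa [pq lq]]]]]; right.
exists w, (a :: q); split=> //; last by rewrite /= pq andbT.
- by rewrite /= sq.
- rewrite cons_uniq uq andbT; apply/negP => /(allP aq).
  by rewrite nth_clear eqxx.
- apply/andP; split=> //; apply: sub_all aq => z.
  by rewrite nth_clear => /andP[].
Qed.

#[local] Arguments ends : simpl never.

Lemma clashP x p q : clash x p q ->
  exists j, [/\ j < size p, nth false p j = x & nth false q j].
Proof.
elim: p q => [|a p IH] [|b q] //=.
case: ifP => [|_ /IH [j [*]]]; last by exists j.+1.
by case: b => // /eqP <- _; exists 0.
Qed.

Lemma clash2P p ps t : clash2 p ps t ->
  exists2 j, j < size ps /\ nth false ps j = false & clash false p (nth [::] t j).
Proof.
elim: ps t => [|a ps IH] [|r t] //=.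
case: ifP => [|_ /IH [j [*]]]; last by exists j.+1.
by case: a => // cl _; exists 0.
Qed.

Lemma meetsP u v : meets u v -> exists2 j, nth false u j & nth false v j.
Proof.
elim: u v => [|x u IH] [|y v] //=.
case: ifP => [|_ /IH [j *]]; last by exists j.+1.
by case: x => // *; exists 0.
Qed.

(** A neighbourhood survives the pruning if none of its initial segments is in
    conflict with the next vertex. *)
Lemma mem_rows S re tr i ps :
    size re = size tr -> i + size re = size S -> take i S \in ps ->
    (forall t, t < size re -> nth false S (i + t) ->
       ~~ clash true (take (i + t) S) (nth [::] re t)) ->
    (forall t, t < size re -> nth false S (i + t) = false ->
       ~~ clash2 (take (i + t) S) (take (i + t) S) (nth [::] tr t)) ->
  S \in rows re tr ps.
Proof.
elim: re tr i ps => [|e re IH] [|t tr] i ps //=.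
  by rewrite addn0 => _ ->; rewrite take_size.
case=> sz; rewrite addnS => szS Sps ctrue cfalse.
have lti : i < size S by rewrite -szS ltnS leq_addr.
apply: (IH _ i.+1) => //.
- apply/flatten_mapP; exists (take i S) => //.
  rewrite (take_nth false lti) mem_cat.
  have := ctrue 0 isT; have := cfalse 0 isT; rewrite addn0 /=.
  case: nth => [_ /(_ isT) /negbTE ->|/(_ erefl) /negbTE -> _].
    by rewrite mem_head.
  by rewrite mem_head orbT.
- by move=> z ltz; rewrite addSnnS; apply: ctrue.
- by move=> z ltz; rewrite addSnnS; apply: cfalse.
Qed.

Lemma cycle_inP d b i rs ms m : (forall i, ~~ edge b i i) ->
    (forall j, nth [::] rs j = nth [::] b (i + j)) ->
    (forall j, nth false ms j -> nth false m (i + j)) ->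
  cycle_in d b i rs ms m ->
  exists z q, [/\ size q = d.+2, uniq (z :: q), all (nth false m) (z :: q),
                  path (edge b) z q & edge b z (last z q)].
Proof.
move=> irr; elim: rs i ms m => [|r rs IH] i [|x ms] m //= rsE msE.
have := rsE 0; have := msE 0; rewrite addn0 /= => mi rE.
case: ifP => [|_ /IH[|j|z [q [sq uq aq pq lq]]]].
- case: x mi msE => // /(_ isT) mi _ /meetsP [c rc] /(endsP irr).
  case=> [|[a [q [sq uq aq ra [pq lq]]]] _]; first by rewrite nth_nseq if_same.
  exists i, (a :: q); split=> //.
  + by rewrite /= sq.
  + apply/andP; split=> //; apply/negP => /(allP aq).
    by rewrite nth_clear eqxx.
  + apply/andP; split=> //; apply: sub_all aq => z.
    by rewrite nth_clear => /andP[].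
  + by rewrite /= {1}/edge -rE ra.
  + by rewrite /= lq /edge -rE.
- by move=> j; rewrite addSnnS -rsE.
- by rewrite nth_clear addSnnS => /(msE j.+1); case: eqP => // /eqP; lia.
- exists z, q; split=> //; apply: sub_all aq => y.
  by rewrite nth_clear => /andP[].
Qed.

Lemma has_cycle_inP d b m : (forall i, ~~ edge b i i) -> has_cycle_in d b m ->
  exists z q, [/\ size q = d.+2, uniq (z :: q), all (nth false m) (z :: q),
                  path (edge b) z q & edge b z (last z q)].
Proof. by move=> irr; apply: cycle_inP. Qed.

(** * Extending a colouring by one vertex *)

Lemma order_perm g : perm_eq (order g) (iota 0 (size g)).
Proof.
rewrite /order; set k := refine _ _.
have sk : size k = size g by rewrite size_map.
rewrite -[X in perm_eq _ X](@unzip2_zip _ _ k) ?size_iota ?sk //.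
by apply: perm_map; rewrite perm_sort.
Qed.

Lemma mem_dedup g l : g \in l -> g \in dedup l.
Proof.
elim: l => // x [|y l] IH //; rewrite inE => /predU1P gl.
have -> : dedup [:: x, y & l] =
  if x == y then dedup (y :: l) else x :: dedup (y :: l) by [].
case: ifP => [/eqP xy|_]; case: gl => [gx|gl].
- by apply: IH; rewrite gx xy mem_head.
- exact: IH.
- by rewrite gx mem_head.
- by rewrite inE IH ?orbT.
Qed.

Lemma mem_collect g l : g \in l -> normalize g \in collect l.
Proof. by move=> gl; apply: mem_dedup; rewrite mem_sort map_f. Qed.

(** The generation loses nothing: in a colouring with no red [n]-cycle and no
    blue wheel, each test that discards a neighbourhood would exhibit one of them. *)
Section Realization.
Variables (V : finType) (red : rel V).
Hypotheses (red_sym : symmetric red) (red_irr : irreflexive red).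
Implicit Types (e : rel V) (s : seq V).

Definition adjacency e s : graph := [seq [seq e x y | y <- s] | x <- s].

Lemma size_adjacency e s : size (adjacency e s) = size s.
Proof. by rewrite size_map. Qed.

Lemma nth_adjacency x0 e s i :
  i < size s -> nth [::] (adjacency e s) i = [seq e (nth x0 s i) y | y <- s].
Proof. by move=> lti; rewrite (nth_map x0). Qed.

Lemma edge_adjacency x0 e s i j : edge (adjacency e s) i j =
  [&& i < size s, j < size s & e (nth x0 s i) (nth x0 s j)].
Proof.
rewrite /edge; case: ltnP => lti; last by rewrite (nth_default [::]) ?size_map ?nth_nil.
rewrite (nth_adjacency x0) //; case: ltnP => ltj; last by rewrite nth_default ?size_map.
by rewrite (nth_map x0).
Qed.

Lemma blue_sym : symmetric (blue red).
Proof. by move=> x y; rewrite /blue eq_sym red_sym. Qed.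

Lemma complement_adjacency s :
  uniq s -> complement (adjacency red s) = adjacency (blue red) s.
Proof.
move=> us; apply: (@eq_from_nth _ [::]); rewrite size_mapi !size_map // => i lti.
case: s us lti => // x0 s' us lti; set s := x0 :: s' in us lti *.
rewrite (nth_mapi _ [::]) ?size_map // !(nth_adjacency x0) //.
apply: (@eq_from_nth _ false); first by rewrite size_clear !size_map.
move=> j; rewrite size_clear !size_map // => ltj.
by rewrite nth_clear -map_comp !(nth_map x0) // /blue nth_uniq // eq_sym.
Qed.

Lemma path_adjacency x0 e s a q : path (edge (adjacency e s)) a q ->
  path e (nth x0 s a) (map (nth x0 s) q).
Proof.
by apply: homo_path => i j; rewrite (edge_adjacency x0) => /and3P[].
Qed.

Lemma uniq_nth x0 s q : uniq s -> uniq q -> {in q, forall i, i < size s} ->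
  uniq (map (nth x0 s) q).
Proof.
move=> us uq qs; rewrite map_inj_in_uniq // => i j /qs lti /qs ltj /eqP.
by rewrite nth_uniq // => /eqP.
Qed.

Lemma notin_nth x0 s v q : v \notin s -> {in q, forall i, i < size s} ->
  v \notin map (nth x0 s) q.
Proof.
by move=> vs qs; apply: contra vs => /mapP [i /qs lti ->]; apply: mem_nth.
Qed.

Variables (n : nat) (s : seq V) (v : V).
Hypotheses (n_ge4 : 3 < n) (us : uniq s) (vs : v \notin s).
Hypotheses (nocycle : no_cycle red n) (nowheel : no_wheel red).

Let bs := adjacency (blue red) s.
Let row := [seq red v x | x <- s].

Lemma edge_bs_irr i : ~~ edge bs i i.
Proof. by rewrite (edge_adjacency v) /blue eqxx !andbF. Qed.

Lemma rowF i : i < size s -> nth false row i = false -> blue red v (nth v s i).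
Proof.
move=> lti; rewrite (nth_map v) // => vi; rewrite /blue vi andbT.
by apply: contraNneq vs => ->; apply: mem_nth.
Qed.

Lemma rowT i : i < size s -> nth false row i -> red v (nth v s i).
Proof. by move=> lti; rewrite (nth_map v). Qed.

(** The new vertex would be the hub of a wheel. *)
Lemma row_no_hexagon : ~~ has_cycle_in 3 bs (map negb row).
Proof.
apply/negP => /(has_cycle_inP edge_bs_irr) [z [q [sq uq aq pq lq]]].
have qs : {in z :: q, forall i, i < size s}.
  by move=> i /(allP aq) /nth_true; rewrite !size_map.
apply: (@nowheel v (map (nth v s) (z :: q))); rewrite ?size_map ?uniq_nth //.
- by rewrite /= sq.
- apply/allP => _ /mapP [i iq ->]; apply: rowF; first exact: qs.
  move/(allP aq): (iq); rewrite (nth_map false) ?size_map ?qs //.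
  by move/negbTE.
rewrite /= rcons_path (path_adjacency v pq) last_map blue_sym.
by move: lq; rewrite (edge_adjacency v) => /and3P[].
Qed.

Lemma row_no_red_clash t : t < size s -> nth false row t ->
  ~~ clash true (take t row) (nth [::] (red_ends n (adjacency red s)) t).
Proof.
move=> lt rt; apply/negP => /clashP [j []]; rewrite size_take size_map lt => jt.
rewrite nth_take // (nth_mapi _ [::]) ?size_map // add0n => rj.
have js : j < size s := ltn_trans jt lt.
case/endsP=> [i||[a [q [sq uq aq ta [pq lq]]]]].
- by rewrite (edge_adjacency v) red_irr !andbF.
- by rewrite nth_mkseq // leqNgt jt.
have qs : {in a :: q, forall i, i < size s /\ i != t}.
  move=> i /(allP aq); rewrite nth_clear => /andP [it].
  by move/nth_true; rewrite size_nseq.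
have qs' : {in [:: t, a & q], forall i, i < size s}.
  by move=> i /predU1P [->//|/qs[]].
apply: (@nocycle (v :: map (nth v s) [:: t, a & q])).
- by rewrite /= size_map sq; lia.
- rewrite cons_uniq notin_nth // andTb; apply: uniq_nth => //.
  by rewrite cons_uniq uq andbT; apply/negP => /qs []; rewrite eqxx.
- rewrite /= rcons_path last_map lq (path_adjacency v pq).
  rewrite rowT //= (red_sym _ v) rowT // andbT.
  by move: ta; rewrite -/(edge _ t a) (edge_adjacency v) => /and3P[].
Qed.

(** The rim consists of the new vertex and of the blue path from [a] to [b]. *)
Lemma hub_ends_wheel h a b : edge (nth [::] (hub_ends bs) h) a b ->
  a < b -> h < size s -> b < size s -> nth false row h = false ->
  nth false row a = false -> nth false row b = false -> False.
Proof.
move=> + ab hs lb vh va vb.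
have la := ltn_trans ab lb.
rewrite /edge (nth_map [::]) ?size_map // (nth_mapi _ [::]) ?size_map // add0n.
rewrite -/(edge bs h a) {1}(edge_adjacency v) => E.
have {E} : blue red (nth v s h) (nth v s a) /\ nth false
   (ends bs 2 (nth [::] bs a) (clear a (nth [::] bs h)) (mkseq (geq a) (size s))) b.
  by move: E; case: ifP => [/and3P [_ _ hb] E|]; rewrite ?nth_nil.
case=> ha /endsP [||[a' [q [sq uq aq aa' [pq lq]]]]].
- exact: edge_bs_irr.
- by rewrite nth_mkseq //= leqNgt ab.
have qs : {in a' :: q, forall i, [/\ i < size s, i != a & blue red (nth v s h) (nth v s i)]}.
  move=> i /(allP aq); rewrite nth_clear => /andP [it].
  by rewrite -/(edge bs h i) (edge_adjacency v) => /and3P[].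
have qs' : {in [:: a, a' & q], forall i, i < size s}.
  by move=> i /predU1P [->//|/qs[]].
have hq : all (blue red (nth v s h)) (map (nth v s) [:: a, a' & q]).
  by rewrite all_map; apply/allP => i /predU1P [->|/qs[]].
apply: (@nowheel (nth v s h) (v :: map (nth v s) [:: a, a' & q])).
- by rewrite /= size_map sq.
- rewrite cons_uniq notin_nth // andTb; apply: uniq_nth => //.
  by rewrite cons_uniq uq andbT; apply/negP => /qs []; rewrite eqxx.
- apply/andP; split; first by rewrite blue_sym rowF.
  by [].
- rewrite /= rcons_path last_map lq (path_adjacency v pq).
  rewrite rowF //= (blue_sym _ v) rowF // andbT.
  by move: aa'; rewrite -/(edge _ a a') (edge_adjacency v) => /and3P[_ _ ->].
Qed.

Lemma row_no_blue_clash t : t < size s -> nth false row t = false ->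
  ~~ clash2 (take t row) (take t row) (nth [::] (hub_triples (hub_ends bs)) t).
Proof.
move=> lt rt; apply/negP => /clash2P [j []]; rewrite size_take size_map lt => jt.
rewrite nth_take // nth_mkseq ?size_map // nth_mkseq // => rj /clashP [l []].
rewrite size_take size_map lt => lt'; rewrite nth_take // => rl lj.
have {lj} : l < j /\ hub_triple (hub_ends bs) t j l.
  by move: (nth_true lj); rewrite size_mkseq => ltlj; rewrite nth_mkseq in lj.
case=> lj /or3P [] /hub_ends_wheel; apply=> //; lia.
Qed.

Lemma mem_new_rows : row \in new_rows n (adjacency red s).
Proof.
rewrite mem_filter complement_adjacency // row_no_hexagon /=.
apply: (@mem_rows _ _ _ 0); rewrite ?take0 ?mem_head //.
- by rewrite size_mapi size_mkseq !size_map.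
- by rewrite size_mapi !size_map.
- by move=> t; rewrite size_mapi size_map add0n; apply: row_no_red_clash.
- by move=> t; rewrite size_mapi size_map add0n; apply: row_no_blue_clash.
Qed.
End Realization.

(** * Cycles of length six and seven *)

Fixpoint all_masks k : seq mask := match k with
  | 0 => [:: [::]]
  | k'.+1 => flatten [seq [:: true :: p; false :: p] | p <- all_masks k'] end.

Lemma mem_all_masks p : p \in all_masks (size p).
Proof.
elim: p => //= b p IH; apply/flatten_mapP; exists p => //.
by case: b; rewrite !inE eqxx ?orbT.
Qed.

(** Each new vertex is adjacent to its predecessor, and the sixth one also to
    the first, so that the vertices form a hexagon in their order. *)
Definition hamiltonian_row (p : mask) :=
  last false p && ((size p < 5) || head false p).
Definition extend (l : seq graph) : seq graph :=
  flatten [seq [seq add_vertex g p | p <- all_masks (size g) & hamiltonian_row p]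
             | g <- l].
Definition point : graph := [:: [:: false]].
Definition hexagons := collect (iter 5 extend [:: point]).

Section Levels.
Variables (V : finType) (red : rel V).
Hypotheses (red_sym : symmetric red) (red_irr : irreflexive red).
Local Notation adj := (adjacency red).

(** A list is a complete level of the generation if it is realized, in this sense,
    in every colouring with no red [n]-cycle and no blue wheel. *)
Definition realized k (l : seq graph) :=
  exists s : seq V, [/\ uniq s, size s = k & adj s \in l].

Lemma add_vertex_adjacency s v :
  add_vertex (adj s) [seq red v x | x <- s] = adj (rcons s v).
Proof.
have add t : add_column [seq [seq red x y | y <- t] | x <- s] [seq red v x | x <- s]
           = [seq [seq red x y | y <- rcons t v] | x <- s].
  by elim: s => //= x s ->; rewrite map_rcons red_sym.
by rewrite /add_vertex add /adjacency [RHS]map_rcons !map_rcons red_irr.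
Qed.

(** Relabelling amounts to listing the same vertices in another order. *)
Lemma realized_collect k l : realized k l -> realized k (collect l).
Proof.
case=> s [us sk sl].
have [s0|[x0 _]] : s = [::] \/ exists x, x \in s.
- by case: (s) => [|x s']; [left | right; exists x; rewrite mem_head].
- by exists [::]; rewrite s0 in us sk sl; split=> //; apply: (mem_collect sl).
set o := order (adj s).
have po : perm_eq o (iota 0 (size s)) by rewrite -(size_adjacency red); apply: order_perm.
have os i : i \in o -> i < size s by rewrite (perm_mem po) mem_iota.
exists (map (nth x0 s) o); split.
- apply: uniq_nth => //; by rewrite (perm_uniq po) iota_uniq.
- by rewrite size_map (perm_size po) size_iota.
suff <- : normalize (adj s) = adj (map (nth x0 s) o) by apply: mem_collect.
rewrite /normalize /relabel -/o [RHS]/adjacency -[RHS]map_comp.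
apply/eq_in_map => i /os lti; rewrite (nth_adjacency x0) //= -[RHS]map_comp.
by apply/eq_in_map => j /os ltj; rewrite (nth_map x0).
Qed.

Lemma realized_next n k l : 3 < n -> no_cycle red n -> no_wheel red ->
  k < #|V| -> realized k l -> realized k.+1 (next_level n l).
Proof.
move=> n4 nc nw kV [s [us sk sl]]; apply: realized_collect.
have [v vs] : exists v, v \notin s.
  apply/existsP; apply: contraTT kV; rewrite negb_exists -leqNgt -sk => /forallP all_s.
  rewrite cardT; apply: uniq_leq_size (enum_uniq _) _ => x _.
  by have := all_s x; rewrite negbK.
exists (rcons s v); rewrite rcons_uniq vs size_rcons sk; split=> //.
apply/flatten_mapP; exists (adj s) => //; rewrite -add_vertex_adjacency.
by apply: map_f; apply: mem_new_rows.
Qed.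

Lemma realized_iter n j k l : 3 < n -> no_cycle red n -> no_wheel red ->
  j + k <= #|V| -> realized k l -> realized (j + k) (iter j (next_level n) l).
Proof.
move=> n4 nc nw; elim: j => //= j IH lt rk.
by apply: realized_next => //; apply: IH => //; apply: ltnW.
Qed.

Lemma realized_point : 0 < #|V| -> realized 1 [:: point].
Proof. by case/card_gt0P=> v _; exists [:: v]; rewrite inE /adjacency /= red_irr. Qed.

Lemma extend_adjacency s v l : adj s \in l -> hamiltonian_row [seq red v x | x <- s] ->
  adj (rcons s v) \in extend l.
Proof.
move=> sl hv; apply/flatten_mapP; exists (adj s) => //; rewrite -add_vertex_adjacency.
by rewrite map_f // mem_filter hv size_adjacency -(size_map (red v) s) mem_all_masks.
Qed.

Lemma realized_hexagons s : size s = 6 -> uniq s -> cycle red s -> realized 6 hexagons.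
Proof.
case: s => [|a [|b [|c [|d [|e [|f [|]]]]]]] // _ us.
rewrite /= andbT => /and5P[ab bc cd de /andP[ef fa]].
apply: realized_collect; exists [:: a; b; c; d; e; f]; split=> //.
have s1 : adj [:: a] \in [:: point] by rewrite inE /adjacency /= red_irr.
apply: (@extend_adjacency [:: a; b; c; d; e] f _); last first.
  by rewrite /hamiltonian_row /= fa (red_sym f) ef.
apply: (@extend_adjacency [:: a; b; c; d] e _); last first.
  by rewrite /hamiltonian_row /= (red_sym e) de.
apply: (@extend_adjacency [:: a; b; c] d _); last first.
  by rewrite /hamiltonian_row /= (red_sym d) cd.
apply: (@extend_adjacency [:: a; b] c _); last first.
  by rewrite /hamiltonian_row /= (red_sym c) bc.
apply: (@extend_adjacency [:: a] b _) => //.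
by rewrite /hamiltonian_row /= (red_sym b) ab.
Qed.
End Levels.

Lemma no_level_6 : iter 10 (next_level 6) [:: point] = [::].
Proof. by vm_cast_no_check (erefl (@nil graph)). Qed.

Lemma no_level_7 : iter 7 (next_level 7) hexagons = [::].
Proof. by vm_cast_no_check (erefl (@nil graph)). Qed.

Section Small.
Variables (V : finType) (red : rel V).
Hypotheses (red_sym : symmetric red) (red_irr : irreflexive red).

(** Otherwise eleven vertices, added one by one, would realize the empty level
    of [no_level_6]. *)
Lemma ramsey6 : 11 <= #|V| -> no_cycle red 6 -> no_wheel red -> False.
Proof.
move=> cV nc nw.
have [] := realized_iter (j := 10) red_sym red_irr _ nc nw cV
  (realized_point red_irr (leq_trans _ cV)) => //.
by move=> s [_ _]; rewrite no_level_6.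
Qed.

Lemma ramsey7 s : 13 <= #|V| -> size s = 6 -> uniq s -> cycle red s ->
  no_cycle red 7 -> no_wheel red -> False.
Proof.
move=> cV ss us cs nc nw.
have [] := realized_iter (j := 7) red_sym red_irr _ nc nw cV
  (realized_hexagons red_sym red_irr ss us cs) => //.
by move=> t [_ _]; rewrite no_level_7.
Qed.
End Small.

(** * Counting arguments *)

Lemma ex_out (V : finType) (S B : {set V}) : #|B| < #|S| -> exists2 x, x \in S & x \notin B.
Proof.
move=> lt; have /subsetPn[x xS xB] : ~~ (S \subset B).
  by apply: contraTN lt => /subset_leq_card; rewrite -leqNgt.
by exists x.
Qed.

(** Were there no two consecutive entries in [r], at least about half of the
    entries would fail it. *)
Lemma ex_adjacent_pair (T : Type) (r : pred T) (p : seq T) :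
  (count (predC r) p).*2.+2 <= size p ->
  exists p1 a b p2, [/\ p = p1 ++ [:: a, b & p2], r a & r b].
Proof.
have [k] := ubnP (size p); elim: k p => // k IH [|a p] //= le_k.
case ra: (r a) => /= lt; last first.
  have [||p1 [a' [b' [p2 [-> ra' rb']]]]] := IH p; try lia.
  by exists (a :: p1), a', b', p2.
case: p le_k lt => [|b p] //= le_k; case rb: (r b) => /= lt.
  by exists [::], a, b, p.
have [||p1 [a' [b' [p2 [-> ra' rb']]]]] := IH p; try lia.
by exists [:: a, b & p1], a', b', p2.
Qed.

Lemma ex_avoid (V : finType) (S B1 B2 : {set V}) (s : seq V) :
    size s + #|B1| + #|B2| < #|S| ->
  exists x, [/\ x \in S, x \notin s, x \notin B1 & x \notin B2].
Proof.
move=> lt; have [|x xS] := @ex_out _ S ([set x in s] :|: (B1 :|: B2)).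
  apply: leq_ltn_trans lt; rewrite -addnA; 
  have [h _] := leq_card_setU [set y in s] (B1 :|: B2); apply: leq_trans h _.
  apply: leq_add; first by rewrite cardsE card_size.
  by have [] := leq_card_setU B1 B2.
by rewrite !inE !negb_or => /and3P [*]; exists x.
Qed.

(** The pigeonhole argument behind the theorem of Dirac: there are [size q]
    pairs of consecutive entries. *)
Lemma ex_crossing (T : Type) (r1 r2 : pred T) u q :
  size q < count r1 (belast u q) + count r2 q ->
  exists q1 x y q2, [/\ u :: q = q1 ++ [:: x, y & q2], r1 x & r2 y].
Proof.
elim: q u => //= y q IH u.
case ru: (r1 u); case ry: (r2 y) => lt; first by exists [::], u, y, q.
all: have [|q1 [x' [y' [q2 [-> rx ry']]]]] := IH y; first by move: lt => /=; lia.
all: by exists (u :: q1), x', y', q2.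
Qed.

(** * Red paths of prescribed length *)

Section Paths.
Variables (V : finType) (red : rel V).
Hypotheses (red_sym : symmetric red) (red_irr : irreflexive red).
Implicit Types S A : {set V}.
Local Notation blue := (blue red).

(** The length [k] counts vertices, so that lengths of disjoint pieces add up. *)
Definition rpath S u v k := exists q, [/\ (size q).+1 = k, uniq (u :: q),
  {subset u :: q <= S}, path red u q & last u q = v].

Lemma rpath_one u : rpath [set u] u u 1.
Proof. by exists [::]; split=> // x; rewrite inE in_set1. Qed.

Lemma rpath_edge u v : red u v -> rpath [set u; v] u v 2.
Proof.
move=> uv; exists [:: v]; split=> //=; last by rewrite uv.
- by rewrite inE andbT; apply: contraTneq uv => ->; rewrite red_irr.
- by move=> x; rewrite !inE.
Qed.

Lemma rpath_sub S S' u v k : S \subset S' -> rpath S u v k -> rpath S' u v k.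
Proof.
by move=> /subsetP sub [q [sq uq Sq pq lq]]; exists q; split=> // x /Sq/sub.
Qed.

Lemma rpath_rev S u v k : rpath S u v k -> rpath S v u k.
Proof.
case=> q [sq uq Sq pq lq]; exists (rev (belast u q)).
have E : v :: rev (belast u q) = rev (u :: q).
  by rewrite -lq -rev_rcons -lastI.
split; rewrite ?size_rev ?size_belast // ?E ?rev_uniq //.
- by move=> x; rewrite mem_rev; apply: Sq.
- by rewrite -lq rev_path; apply: sub_path pq => x y; rewrite red_sym.
- by rewrite -[LHS](last_cons v) E rev_cons last_rcons.
Qed.

Lemma rpath_cat S S' u v u' v' k k' : rpath S u v k -> rpath S' u' v' k' ->
  red v u' -> [disjoint S & S'] -> rpath (S :|: S') u v' (k + k').
Proof.
move=> [q [sq uq Sq pq lq]] [q' [sq' uq' Sq' pq' lq']] vu' dis.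
exists (q ++ u' :: q'); split.
- by rewrite size_cat /= -sq -sq' addSn addnS.
- rewrite -cat_cons cat_uniq uq uq' andbT andTb; apply/hasPn => x /Sq' xS'.
  by apply: contraL xS' => /Sq xS; rewrite (disjointFr dis xS).
- by move=> x; rewrite -cat_cons mem_cat in_setU => /orP[/Sq|/Sq'] ->; rewrite ?orbT.
- by rewrite cat_path /= pq lq vu'.
- by rewrite last_cat.
Qed.

Lemma rpath_cycle n S S' u v u' v' k k' : no_cycle red n ->
  rpath S u v k -> rpath S' u' v' k' -> red v u' -> red v' u ->
  [disjoint S & S'] -> k + k' = n -> False.
Proof.
move=> nc p p' vu' vu dis kn.
have [q [sq uq _ pq lq]] := rpath_cat p p' vu' dis.
apply: (nc (u :: q)) => //=; first by rewrite sq.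
by rewrite rcons_path pq lq.
Qed.

(** The two triples alternate along the rim. *)
Lemma no_wheel_triples h S (T : {set V}) : no_wheel red -> 2 < #|S| -> 2 < #|T| ->
  (forall s, s \in S -> blue h s) -> (forall t, t \in T -> blue h t) ->
  (forall s t, s \in S -> t \in T -> blue s t) -> False.
Proof.
move=> nw /card_gt2P[s1 [s2 [s3 [[S1 S2 S3] [s12 s23 s31]]]]].
move=> /card_gt2P[t1 [t2 [t3 [[T1 T2 T3] [t12 t23 t31]]]]] hS hT ST.
have ne s t : s \in S -> t \in T -> s != t by move=> sS tT; case/andP: (ST s t sS tT).
have ne' t s : t \in T -> s \in S -> t != s by move=> *; rewrite eq_sym ne.
have TS t s : t \in T -> s \in S -> blue t s.
  by move=> *; rewrite blue_sym // ST.
apply: (nw h [:: s1; t1; s2; t2; s3; t3]) => //=.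
- rewrite !inE !negb_or (ne s1 t1) ?(ne s1 t2) ?(ne s1 t3) ?(ne s2 t2) //.
  rewrite (ne s2 t3) ?(ne s3 t3) ?(ne' t1 s2) ?(ne' t1 s3) ?(ne' t2 s3) //.
  by rewrite s12 s23 t12 t23 (eq_sym s1 s3) s31 (eq_sym t1 t3) t31.
- by rewrite (hS s1) ?(hS s2) ?(hS s3) ?hT.
- by rewrite (ST s1) ?(ST s2) ?(ST s3) ?TS.
Qed.

Definition blue_nbrs A v := [set w in A | blue v w].
Definition red_nbrs A v := [set w in A | red v w].

Lemma not_blue_nbr A v w : w \in A -> w != v -> w \notin blue_nbrs A v -> red v w.
Proof. by move=> wA wv; rewrite inE wA /blue eq_sym wv /= negbK. Qed.

Lemma count_blue A w s : #|blue_nbrs A w| <= 2 -> uniq s -> {subset s <= A} ->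
  w \notin s -> count (predC (red w)) s <= 2.
Proof.
move=> bw us sA ws.
rewrite -size_filter -(card_uniqP (filter_uniq _ us)); apply: leq_trans bw.
apply/subset_leq_card/subsetP => x; rewrite mem_filter => /andP[/= nr xs].
by rewrite inE sA //= /blue nr andbT; apply: contraNneq ws => ->.
Qed.

Lemma rpath_insert A u v q w p1 a b p2 : uniq (u :: q) -> {subset u :: q <= A} ->
  path red u q -> last u q = v -> w \in A -> w \notin u :: q ->
  u :: q = p1 ++ [:: a, b & p2] -> red w a -> red w b ->
  rpath A u v (size q).+2.
Proof.
move=> uq Aq pq lq wA wq E wa wb.
rewrite -cat_rcons headI in E; case: E => uE qE.
set p := behead _ in qE.
have lp : last u p = a by have := last_rcons a p1 a; rewrite headI /= -uE.
exists (p ++ [:: w, b & p2]); split.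
- by rewrite qE !size_cat /= addnS.
- by rewrite -cat_cons -(cat1s w) uniq_catCA cat_cons -qE cat1s cons_uniq wq uq.
- move=> x; rewrite -cat_cons mem_cat [x \in w :: _]in_cons orbCA -mem_cat cat_cons -qE.
  by case/predU1P => [->//|/Aq].
- move: pq; rewrite qE !cat_path /= lp => /and3P[-> _ ->].
  by rewrite red_sym wa wb.
- by rewrite -lq qE !last_cat.
Qed.

(** A vertex of [A] outside the path misses at most two vertices of it, hence is
    red to two consecutive ones and can be inserted between them. *)
Lemma rpath_extend A u v k : (forall w, w \in A -> #|blue_nbrs A w| <= 2) ->
  5 < k < #|A| -> rpath A u v k -> rpath A u v k.+1.
Proof.
move=> bA /andP[k5 kA] [q [sq uq Aq pq lq]].
have [|w [wA wq _ _]] := @ex_avoid _ A set0 set0 (u :: q).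
  by rewrite cards0 /= sq !addn0.
have cq := count_blue (bA w wA) uq Aq wq.
have [|p1 [a [b [p2 [E wa wb]]]]] := @ex_adjacent_pair _ (red w) (u :: q).
  by move: cq; rewrite [size _]/= sq; lia.
by rewrite -sq; apply: rpath_insert E wa wb.
Qed.

(** For so short a path the insertion argument is not available, and the middle
    vertices are chosen greedily. *)
Lemma rpath_five A u v : (forall w, w \in A -> #|blue_nbrs A w| <= 2) ->
  6 < #|A| -> u \in A -> v \in A -> u != v -> rpath A u v 5.
Proof.
(* If u has a blue neighbour p other than v, the path u, a, p, b, v is sought: p
   and u already use up one blue neighbour of each other, which leaves a and b to
   choose.  If neither end has such a neighbour, the ends are red to all other
   vertices, and any middle vertex c will do. *)
move=> bA A7; wlog [p [pA pu pv bp]] : u v / exists p,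
    [/\ p \in A, p != u, p != v & p \in blue_nbrs A u].
  move=> wl uA vA uv.
  have [|nu] := boolP [exists p in A, [&& p != u, p != v & p \in blue_nbrs A u]].
    by case/exists_inP=> p pA /and3P [*]; apply: wl => //; exists p.
  have [|nv] := boolP [exists p in A, [&& p != u, p != v & p \in blue_nbrs A v]].
    case/exists_inP=> p pA /and3P [*]; apply/rpath_rev/wl => //; last by rewrite eq_sym.
    by exists p.
  have redP p : p \in A -> p != u -> p != v -> red u p && red v p.
    move=> pA pu pv; move: nu nv; rewrite !negb_exists_in.
    move=> /forall_inP/(_ p pA); rewrite pu pv /= => nu.
    move=> /forall_inP/(_ p pA); rewrite pu pv /= => nv.
    by rewrite !(@not_blue_nbr A).
  have [|c [cA]] := @ex_avoid _ A set0 set0 [:: u; v].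
    by rewrite cards0 /=; lia.
  rewrite !inE !negb_or => /andP[cu cv] _ _.
  have [|a [aA]] := @ex_avoid _ A (blue_nbrs A c) set0 [:: u; v; c].
    by rewrite cards0; have := bA c cA; move=> /=; lia.
  rewrite !inE !negb_or => /and3P[au av ac] ca _.
  have [|b [bA']] := @ex_avoid _ A (blue_nbrs A c) set0 [:: u; v; c; a].
    by rewrite cards0; have := bA c cA; move=> /=; lia.
  rewrite !inE !negb_or => /and4P[bu bv bc ba] cb _.
  have /andP[ua _] := redP a aA au av; have /andP[_ vb] := redP b bA' bu bv.
  have {}ca : red c a by apply: (@not_blue_nbr A); rewrite ?inE.
  have {}cb : red c b by apply: (@not_blue_nbr A); rewrite ?inE.
  exists [:: a; c; b; v]; split=> //=.
  - rewrite !inE !negb_or uv cv bv av (eq_sym u a) au (eq_sym u c) cu (eq_sym u b) bu.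
    by rewrite ac (eq_sym a b) ba (eq_sym c b) bc.
  - by move=> x; rewrite !inE => /or4P[|||/orP[]] /eqP->.
  - by rewrite ua (red_sym a) ca cb red_sym vb.
move=> uA vA uv; have := bA p pA; have := bA u uA; have := bA v vA => bv bu bp'.
have up : u \in blue_nbrs A p.
  by move: bp; rewrite !inE uA pA /= blue_sym.
have [|b [bA']] := @ex_avoid _ A (blue_nbrs A p) (blue_nbrs A v) [:: v; p].
  by move=> /=; lia.
rewrite !inE negb_or => /andP[b_v b_p] bp1 bv1.
have [|a [aA]] := @ex_avoid _ A (blue_nbrs A p) (blue_nbrs A u) [:: v; b].
  by move=> /=; lia.
rewrite !inE negb_or => /andP[a_v a_b] ap1 au1.
have b_u : b != u by apply: contraNneq bp1 => ->; move: up; rewrite inE.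
have a_u : a != u by apply: contraNneq ap1 => ->; move: up; rewrite inE.
have a_p : a != p by apply: contraNneq au1 => ->; move: bp; rewrite inE.
have pa : red p a by apply: (@not_blue_nbr A); rewrite ?inE.
have pb : red p b by apply: (@not_blue_nbr A); rewrite ?inE.
have ua : red u a by apply: (@not_blue_nbr A); rewrite ?inE.
have vb : red v b by apply: (@not_blue_nbr A); rewrite ?inE.
exists [:: a; p; b; v]; split=> //=.
- rewrite !inE !negb_or uv pv b_v a_v (eq_sym u a) a_u (eq_sym u p) pu (eq_sym u b).
  by rewrite b_u a_p a_b (eq_sym p b) b_p.
- by move=> x; rewrite !inE => /or4P[|||/orP[]] /eqP->.
- by rewrite ua (red_sym a) pa pb red_sym vb.
Qed.

(** Let [w] and [w'] be off a path [u, a, b, c, v] into which neither can be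
    inserted.  Then each is blue to exactly [a] and [c], so red to everything
    else, and [u, w, w', b, c, v] is a path. *)
Lemma rpath_six A u v : (forall w, w \in A -> #|blue_nbrs A w| <= 2) ->
  6 < #|A| -> u \in A -> v \in A -> u != v -> rpath A u v 6.
Proof.
move=> bA A7 uA vA uv; have [q [sq uq Aq pq lq]] := rpath_five bA A7 uA vA uv.
have [|w [wA wq _ _]] := @ex_avoid _ A set0 set0 (u :: q).
  by rewrite cards0 /= sq; lia.
have [|w' [w'A]] := @ex_avoid _ A set0 set0 (w :: u :: q).
  by rewrite cards0 /= sq; lia.
rewrite in_cons negb_or => /andP[w'w w'q] _ _.
case: q sq uq Aq pq lq wq w'q => [|a [|b [|c [|d []]]]] // _ uq Aq pq lq wq w'q.
have [[aA bA'] cA] : (a \in A /\ b \in A) /\ c \in A.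
  by rewrite !Aq // !inE eqxx !orbT.
rewrite /= in lq; subst d; move: pq; rewrite /= andbT => /and4P[ua ab bc cv].
move: uq wq w'q; rewrite /= !inE !negb_or -!andbA.
case/and5P=> u_a u_b u_c u_v /and5P[a_b a_c a_v b_c /andP[b_v c_v]].
case/and5P=> w_u w_a w_b w_c w_v /and5P[w'_u w'_a w'_b w'_c w'_v].
have uq : uniq [:: u; a; b; c; v].
  by rewrite /= !inE !negb_or u_a u_b u_c u_v a_b a_c a_v b_c b_v.
have pq : path red u [:: a; b; c; v] by rewrite /= ua ab bc cv.
(* The red neighbours of z on the path are pairwise not consecutive. *)
have key z z' : z \in A -> z' \in A -> z' != z -> z \notin [:: u; a; b; c; v] ->
    z' \notin [:: u; a; b; c; v] ->
    rpath A u v 6 \/ [/\ red z u, red z b & red z z'].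
  move=> zA z'A z'z zq z'q.
  have ins p1 x y p2 := @rpath_insert A u v _ z p1 x y p2 uq Aq pq erefl zA zq.
  have : count (predC (red z)) [:: z'; u; a; b; c; v] <= 2.
    apply: (count_blue (bA z zA)); first by rewrite cons_uniq z'q.
      by move=> x /predU1P [->//|/Aq].
    by rewrite in_cons negb_or zq eq_sym z'z.
  rewrite /=; case ru: (red z u); case ra: (red z a); case rb: (red z b);
    case rc: (red z c); case rv: (red z v); case rz: (red z z') => //= _;
    by [right | left; apply: (ins [::] _ _ [:: b; c; v] _ ru ra)
      | left; apply: (ins [:: u] _ _ [:: c; v] _ ra rb)
      | left; apply: (ins [:: u; a] _ _ [:: v] _ rb rc)
      | left; apply: (ins [:: u; a; b] _ _ [::] _ rc rv)].
have wq : w \notin [:: u; a; b; c; v] by rewrite !inE !negb_or w_u w_a w_b w_c.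
have w'q : w' \notin [:: u; a; b; c; v] by rewrite !inE !negb_or w'_u w'_a w'_b w'_c.
have [//|[wu wb ww']] := key w w' wA w'A w'w wq w'q.
have [|//|[w'u w'b _]] := key w' w w'A wA _ w'q wq; first by rewrite eq_sym.
exists [:: w; w'; b; c; v]; split=> //=.
- move: wq w'q; rewrite !inE !negb_or (eq_sym w w') w'w.
  rewrite u_b u_c u_v b_c b_v c_v (eq_sym u w) (eq_sym u w').
  by case/and5P=> -> _ -> -> -> /and5P[-> _ -> -> ->].
- by move=> x; rewrite !inE => /or4P[|||/or3P[]] /eqP->.
- by rewrite (red_sym u) wu ww' w'b bc cv.
Qed.

Lemma panconnected A u v k : (forall w, w \in A -> #|blue_nbrs A w| <= 2) ->
  6 < #|A| -> u \in A -> v \in A -> u != v -> 5 <= k <= #|A| -> rpath A u v k.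
Proof.
move=> bA A7 uA vA uv; elim: k => // k IH /andP[]; rewrite ltnS leq_eqVlt.
case/predU1P => [<- _|k4 kA]; first exact: rpath_five.
move: k4; rewrite leq_eqVlt => /predU1P [<-|k5]; first exact: rpath_six.
by apply: rpath_extend; rewrite ?k5 //; apply: IH; lia.
Qed.
(** * Dirac's theorem *)

(** With the red chords [v x] and [u y] across a red edge [x y] of a path from
    [u] to [v], the path closes up after reversal of the part that starts at [y]. *)
Lemma cycle_of_crossing u q q1 x y q2 : path red u q -> u :: q = q1 ++ [:: x, y & q2] ->
  red (last u q) x -> red u y -> exists2 t, perm_eq t (u :: q) & cycle red t.
Proof.
move=> pq E vx uy; exists (q1 ++ x :: rev (y :: q2)).
  by rewrite E perm_cat2l perm_cons perm_rev.
have lq : last u q = last y q2 by rewrite -[LHS](last_cons u) E last_cat.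
rewrite -cat_rcons headI in E; case: E => uE qE.
rewrite -cat_rcons headI -uE; set p := behead _ in qE *.
have lp : last u p = x by have := last_rcons x q1 x; rewrite headI /= -uE.
have R : rev (y :: q2) = last y q2 :: rev (belast y q2).
  by rewrite lastI rev_rcons.
have ly : last (last y q2) (rev (belast y q2)) = y.
  by rewrite -[LHS](last_cons y) -R rev_cons last_rcons.
move: pq; rewrite qE cat_path /= lp => /and3P[pp xy pq2].
rewrite R rcons_path last_cat cat_path pp lp /= -lq red_sym vx /= lq ly red_sym uy andbT.
by rewrite rev_path; apply: sub_path pq2 => a b; rewrite red_sym.
Qed.

(** If an end of the path has a neighbour off the path, the path grows.  Otherwise
    all neighbours of both ends are on it, a crossing turns it into a cycle, and
    the degree condition makes any vertex off this cycle adjacent to the cycle, which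
    is opened there into a longer path. *)
Lemma dirac_step S u v k : {in S, forall x, #|S| <= (#|red_nbrs S x|).*2} ->
  rpath S u v k -> (exists s, [/\ size s = #|S|, uniq s & cycle red s]) \/
    k < #|S| /\ exists u' v', rpath S u' v' k.+1.
Proof.
move=> dS [q [sq uq Sq pq lq]].
have uS : u \in S by apply: Sq; rewrite mem_head.
have vS : v \in S by rewrite -lq Sq ?mem_last.
have out w : w \in S -> w \notin u :: q -> k < #|S|.
  move=> wS wq; rewrite -sq -/(size (w :: u :: q)).
  have /card_uniqP <- : uniq (w :: u :: q) by rewrite cons_uniq wq.
  by apply/subset_leq_card/subsetP => y /predU1P [->//|/Sq].
have grow w s : w \in S -> w \notin u :: q -> perm_eq s (u :: q) ->
    path red w s -> k < #|S| /\ exists u' v', rpath S u' v' k.+1.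
  move=> wS wq ps rs; split; first exact: out wS wq.
  exists w, (last w s), s; split=> //; first by rewrite (perm_size ps) /= sq.
    by rewrite cons_uniq (perm_mem ps) wq (perm_uniq ps).
  by move=> y; rewrite in_cons (perm_mem ps) => /predU1P [->//|/Sq].
have nbr x (s : seq V) : x \in S -> {subset red_nbrs S x <= s} -> uniq s ->
    #|S| <= (count (red x) s).*2.
  move=> xS sub us; apply: leq_trans (dS x xS) _; rewrite leq_double.
  rewrite -size_filter -(card_uniqP (filter_uniq _ us)).
  apply/subset_leq_card/subsetP => y yx; rewrite mem_filter sub // andbT.
  by move: yx; rewrite inE => /andP[].
have [|nu] := boolP [exists w in S, (w \notin u :: q) && red u w].
  case/exists_inP=> w wS /andP[wq uw]; right; apply: (grow w (u :: q)) => //.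
  by rewrite /= red_sym uw.
have [|nv] := boolP [exists w in S, (w \notin u :: q) && red v w].
  case/exists_inP=> w wS /andP[wq vw]; right; apply: (grow w (rev (u :: q))) => //.
    by rewrite perm_rev.
  have -> : rev (u :: q) = last u q :: rev (belast u q) by rewrite lastI rev_rcons.
  rewrite /= rev_path lq red_sym vw.
  by apply: sub_path pq => a b; rewrite red_sym.
have inq x y : x \in S -> ~~ [exists w in S, (w \notin u :: q) && red x w] ->
    y \in red_nbrs S x -> y \in u :: q.
  move=> xS; rewrite negb_exists_in inE => /forall_inP nx /andP[yS xy].
  by have := nx y yS; rewrite xy andbT negbK.
have cu : #|S| <= (count (red u) q).*2.
  apply: nbr => //; last by case/andP: uq.
  move=> y yu; have := inq u y uS nu yu; rewrite in_cons => /predU1P [yE|//].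
  by move: yu; rewrite yE inE red_irr andbF.
have cv : #|S| <= (count (red v) (belast u q)).*2.
  have := uq; rewrite lastI lq rcons_uniq => /andP[_ ub].
  apply: nbr => // y yv; have := inq v y vS nv yv.
  rewrite lastI lq mem_rcons in_cons => /predU1P [yE|//].
  by move: yv; rewrite yE inE red_irr andbF.
have kS : k <= #|S|.
  rewrite -sq -/(size (u :: q)) -(card_uniqP uq).
  by apply/subset_leq_card/subsetP.
have [|q1 [x [y [q2 [E vx uy]]]]] := @ex_crossing _ (red v) (red u) u q.
  rewrite -ltn_double doubleD; apply: leq_trans (leq_add cv cu).
  by rewrite addnn ltn_double sq.
rewrite -lq in vx; have [t tq ct] := cycle_of_crossing pq E vx uy.
have [kS'|kS'] := eqVneq k #|S|.
  by left; exists t; rewrite (perm_size tq) (perm_uniq tq) /= sq.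
right; have [|w wS wq] := @ex_out _ S [set z in u :: q].
  by rewrite cardsE (card_uniqP uq) /= sq; lia.
rewrite inE in wq.
have [|z zw zq] := @ex_out _ (red_nbrs S w) (S :\: [set z in w :: u :: q]).
  have wuq : uniq (w :: u :: q) by rewrite cons_uniq wq.
  have c3 : #|[set z in w :: u :: q]| = k.+1.
    by rewrite cardsE (card_uniqP wuq) /= sq.
  have := dS w wS; rewrite cardsD (setIidPr _); last first.
    by apply/subsetP => a; rewrite inE => /predU1P [->//|/Sq].
  have arith a b c l : l.+1 = k -> c <= l -> k <= a -> a <= c.*2 -> a <= b.*2 ->
    a - k.+1 < b by lia.
  by rewrite c3; apply: arith sq (count_size _ _) kS cu.
have {zw zq} [wz zt] : red w z /\ z \in t.
  move: zw zq; rewrite !inE => /andP[-> wz]; rewrite andbT negbK (perm_mem tq) in_cons.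
  by case/predU1P => [zw|]; first by rewrite zw red_irr in wz.
have [i t' tE] := rot_to zt; apply: (grow w (z :: t')) => //.
  by rewrite -tE perm_rot.
by move: ct; rewrite -(rot_cycle i) tE /= wz rcons_path => /andP[].
Qed.

Lemma dirac S : 2 < #|S| -> {in S, forall x, #|S| <= (#|red_nbrs S x|).*2} ->
  exists s, [/\ size s = #|S|, uniq s & cycle red s].
Proof.
move=> S3 dS.
suff grow d k u v : k + d = #|S| -> rpath S u v k ->
    exists s, [/\ size s = #|S|, uniq s & cycle red s].
  have /card_gt0P[x xS] : 0 < #|S| by lia.
  apply: (grow (#|S|.-1) 1 x x); first lia.
  by apply: rpath_sub (rpath_one x); rewrite sub1set.
elim: d k u v => [|d IH] k u v kd /(dirac_step dS) [//|[lt [u' [v' p']]]].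
  lia.
by apply: (IH k.+1 u' v') => //; lia.
Qed.
End Paths.

(** * Rerouting a red cycle *)

(** A closed walk indexed by all natural numbers, periodic and injective on each
    period: arcs that wrap around can be written as intervals, without reductions
    modulo [m]. *)
Definition cyclic (V : finType) (red : rel V) m (c : nat -> V) :=
  [/\ forall i, c (i + m) = c i, forall i, red (c i) (c i.+1) &
      forall a i j, a <= i < a + m -> a <= j < a + m -> c i = c j -> i = j].

Lemma cyclic_nth (V : finType) (red : rel V) x0 s : uniq s -> cycle red s -> 0 < size s ->
  cyclic red (size s) (fun i => nth x0 s (i %% size s)).
Proof.
move=> us cs s0; split=> [i|i|a i j ai aj /eqP].
- by rewrite modnDr.
- case: s cs s0 {us} => // y s; rewrite /= => /(pathP x0) rs _.
  have lt := ltn_pmod i (ltn0Sn (size s)).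
  have := rs (i %% (size s).+1); rewrite size_rcons => /(_ lt).
  rewrite -rcons_cons !nth_rcons /= lt.
  have -> : i.+1 %% (size s).+1 = (i %% (size s).+1).+1 %% (size s).+1.
    by rewrite -(addn1 (i %% _)) modnDml addn1.
  have [lt'|ge] := ltnP (i %% (size s).+1) (size s); first by rewrite (@modn_small (_ %% _).+1).
  have -> : i %% (size s).+1 = size s by apply/eqP; rewrite eqn_leq ge -ltnS lt.
  by rewrite eqxx modnn.
rewrite nth_uniq ?ltn_pmod //.
wlog ij : i j ai aj / i <= j.
  by move=> wl; case/orP: (leq_total i j) => ij; [|rewrite eq_sym => E; symmetry; move: E]; apply: wl.
rewrite eq_sym eqn_mod_dvd // => d; apply/eqP; rewrite eqn_leq ij -subn_eq0.
by apply: contraLR d => nz; rewrite gtnNdvd //; lia.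
Qed.

Lemma cyclic_modn (V : finType) (red : rel V) m c i : cyclic red m c -> c (i %% m) = c i.
Proof.
case=> per _ _; rewrite [in RHS](divn_eq i m) addnC.
by elim: (i %/ m) => [|k ->]; rewrite ?addn0 // mulSn (addnC m) addnA per.
Qed.

Lemma cyclic_shift (V : finType) (red : rel V) m c k :
  cyclic red m c -> cyclic red m (fun i => c (i + k)).
Proof.
case=> per adj inj; split=> [i|i|a i j ai aj].
- by rewrite addnAC per.
- by rewrite addSn.
by move/(inj (a + k)) => e; apply: (@addIn k); apply: e; lia.
Qed.

Lemma disjoint_setU (V : finType) (S T U : {set V}) :
  [disjoint S :|: T & U] = [disjoint S & U] && [disjoint T & U].
Proof. by rewrite -!setI_eq0 setIUl setU_eq0. Qed.

Lemma disjoint_setUr (V : finType) (S T U : {set V}) :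
  [disjoint U & S :|: T] = [disjoint U & S] && [disjoint U & T].
Proof. by rewrite -!setI_eq0 setIUr setU_eq0. Qed.

Section Cycle.
Variables (V : finType) (red : rel V).
Hypotheses (red_sym : symmetric red) (red_irr : irreflexive red).
Variables (m : nat) (c : nat -> V).
Hypotheses (cC : cyclic red m c) (m_gt2 : 2 < m).
Hypotheses (nocycle : no_cycle red m.+1) (nowheel : no_wheel red).
Local Notation blue := (blue red).
Local Notation rpath := (rpath red).

Let cP i : c (i + m) = c i. Proof. by case: cC. Qed.
Let cR i : red (c i) (c i.+1). Proof. by case: cC. Qed.
Let cI a i j : a <= i < a + m -> a <= j < a + m -> c i = c j -> i = j.
Proof. by case: cC => _ _; apply. Qed.

Definition carrier : {set V} := [set c i | i : 'I_m].
Definition arc a b : {set V} := [set v in [seq c i | i <- iota a (b.+1 - a)]].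

Lemma arcP v a b : reflect (exists2 i, a <= i <= b & v = c i) (v \in arc a b).
Proof.
rewrite inE; apply: (iffP mapP) => -[i ai ->]; exists i => //; move: ai;
  rewrite mem_iota; lia.
Qed.

Lemma mem_carrier i : c i \in carrier.
Proof.
have im : i %% m < m by apply: ltn_pmod; lia.
by apply/imsetP; exists (Ordinal im); rewrite //= (cyclic_modn i cC).
Qed.

Lemma card_carrier : #|carrier| = m.
Proof.
rewrite card_imset ?card_ord // => i j; have := ltn_ord i; have := ltn_ord j.
by move=> jm im /(@cI 0) ij; apply/val_inj/ij; lia.
Qed.

Lemma arc_sub a b : arc a b \subset carrier.
Proof. by apply/subsetP => _ /arcP[i _ ->]; apply: mem_carrier. Qed.

Lemma arc_disjoint w a b a' b' : w <= a -> b < a' -> b' < w + m ->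
  [disjoint arc a b & arc a' b'].
Proof.
move=> wa ba' b'w; rewrite -setI_eq0; apply/eqP/setP => v; rewrite !inE.
rewrite -!(in_set (fun v => v \in map _ _)); apply/negP => /andP[].
move=> /(arcP _ a b)[i ai ->] /(arcP _ a' b')[j aj] /(@cI w); lia.
Qed.

Lemma arc_rpath a b k : a <= b < a + m -> k = b.+1 - a ->
  rpath (arc a b) (c a) (c b) k.
Proof.
move=> ab {k}->; have E : c a :: [seq c i | i <- iota a.+1 (b - a)] = [seq c i | i <- iota a (b.+1 - a)].
  by rewrite subSn //; lia.
exists [seq c i | i <- iota a.+1 (b - a)]; rewrite E; split.
- by rewrite size_map size_iota subSn //; lia.
- rewrite map_inj_in_uniq ?iota_uniq // => i j; rewrite !mem_iota => ai aj.
  by apply: (@cI a); lia.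
- by move=> v; rewrite inE.
- by move: (b - a) => k; elim: k (a) => //= k IH i; rewrite cR IH.
- have -> : b = a + (b - a) by lia.
  rewrite addKn; move: (b - a) => k.
  by elim: k (a) => [|k IH] i /=; rewrite ?addn0 // IH addSnnS.
Qed.

Section Outside.
Variable x : V.
Hypothesis xC : x \notin carrier.

Lemma outside_arc a b : [disjoint [set x] & arc a b].
Proof. by rewrite disjoints1; apply: contra xC; apply/subsetP/arc_sub. Qed.

(** The vertex [x] could be inserted between them. *)
Lemma no_consecutive i : red x (c i) -> ~~ red x (c i.+1).
Proof.
move=> xi; apply/negP => xi'.
have p : rpath (arc i.+1 (i + m)) (c i.+1) (c i) m.
  by rewrite -(cP i); apply: arc_rpath; lia.
apply: (rpath_cycle nocycle (rpath_one red x) p) => //; first by rewrite red_sym.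
exact: outside_arc.
Qed.

(** Otherwise [x] extends the cycle: from [x] go to [c j], back to [c i.+1],
    across to [c j.+1] and on to [c i]. *)
Lemma successors_blue i j : i < j < i + m -> red x (c i) -> red x (c j) ->
  ~~ red (c i.+1) (c j.+1).
Proof.
move=> ij xi xj; apply/negP => ij'.
have p1 : rpath (arc i.+1 j) (c j) (c i.+1) (j - i).
  by apply/(rpath_rev red_sym)/arc_rpath; lia.
have p2 : rpath (arc j.+1 (i + m)) (c j.+1) (c i) (i + m - j).
  by rewrite -(cP i); apply: arc_rpath; lia.
have px := rpath_cat (rpath_one red x) p1 xj (outside_arc _ _).
apply: (rpath_cycle nocycle px p2) => //; try lia.
  by rewrite red_sym.
by rewrite disjoint_setU outside_arc (@arc_disjoint i.+1); lia.
Qed.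

(** Otherwise [x] and [y] could replace [c j.+1]: the arcs from [c i.+1] to [c j]
    and from [c j.+2] to [c i] are joined by [x] at [c j] and [c i], and by [y] at the
    other ends. *)
Lemma shifted_neighbours y i j : y \notin carrier -> y != x -> i < j -> j.+2 <= i + m ->
  red x (c i) -> red x (c j) -> red y (c i.+1) -> ~~ red y (c j.+2).
Proof.
move=> yC yx ij jm xi xj yi; apply/negP => yj.
have p1 : rpath (arc i.+1 j) (c i.+1) (c j) (j - i).
  by apply: arc_rpath; lia.
have p2 : rpath (arc j.+2 (i + m)) (c i) (c j.+2) (i + m - j.+1).
  by rewrite -(cP i); apply/(rpath_rev red_sym)/arc_rpath; lia.
have yarc a b : [disjoint [set y] & arc a b].
  by rewrite disjoints1; apply: contra yC; apply/subsetP/arc_sub.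
have px := rpath_cat (rpath_one red x) p2 xi (outside_arc _ _).
have py := rpath_cat (rpath_one red y) p1 yi (yarc _ _).
apply: (rpath_cycle nocycle py px) => //; try lia.
- by rewrite red_sym.
- by rewrite red_sym.
rewrite disjoint_setU !disjoint_setUr yarc disjoints1 inE yx.
by rewrite (disjoint_sym (arc _ _)) outside_arc (@arc_disjoint i.+1) //; lia.
Qed.

(** The path [x, y] could replace [c i.+1]. *)
Lemma red_pair_distance y i : y \notin carrier -> red x y -> red x (c i) -> ~~ red y (c i.+2).
Proof.
move=> yC xy xi; apply/negP => yi.
have p : rpath (arc i.+2 (i + m)) (c i.+2) (c i) m.-1.
  by rewrite -(cP i); apply: arc_rpath; lia.
apply: (rpath_cycle nocycle (rpath_edge red_irr xy) p) => //; try lia.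
  by rewrite red_sym.
rewrite disjoint_setU outside_arc disjoints1.
by apply: contra yC; apply/subsetP/arc_sub.
Qed.
End Outside.
End Cycle.

(** * A blue clique and the vertices attached to it *)

(** [Q] is a blue clique, the vertices of [A] are those with a red neighbour in
    [Q], and [U] consists of the vertices with none. *)
Section Attachment.
Variables (V : finType) (red : rel V).
Hypotheses (red_sym : symmetric red) (red_irr : irreflexive red).
Variable m : nat.
Hypotheses (nocycle : no_cycle red m.+1) (nowheel : no_wheel red) (m_gt6 : 6 < m).
Local Notation blue := (blue red).
Local Notation blue_sym := (blue_sym red_sym).
Variables (Q A U : {set V}).
Hypotheses (Q_gt3 : 3 < #|Q|) (cardAU : #|A| + #|U| = m) (U_le2 : #|U| <= 2).
Hypotheses (dQA : [disjoint Q & A]) (dQU : [disjoint Q & U]) (dAU : [disjoint A & U]).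
Hypothesis blueQ : forall p q, p \in Q -> q \in Q -> p != q -> blue p q.
Hypothesis blueUQ : forall u q, u \in U -> q \in Q -> blue u q.
Hypothesis blueA : forall a, a \in A -> #|blue_nbrs red A a| <= 2.

Let neQA q a : q \in Q -> a \in A -> q != a.
Proof. by move=> qQ; apply: contraTneq => <-; rewrite (disjointFr dQA). Qed.
Let neAU a u : a \in A -> u \in U -> a != u.
Proof. by move=> aA; apply: contraTneq => <-; rewrite (disjointFr dAU). Qed.
Let neQU q u : q \in Q -> u \in U -> q != u.
Proof. by move=> qQ; apply: contraTneq => <-; rewrite (disjointFr dQU). Qed.

Lemma three_others q0 : q0 \in Q -> exists q1 q2 q3,
  [/\ q1 \in Q, q2 \in Q & q3 \in Q] /\
  [/\ uniq [:: q0; q1; q2; q3], blue q0 q1, blue q0 q2 & blue q0 q3] /\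
  [/\ blue q1 q2, blue q2 q3 & blue q3 q1].
Proof.
move=> Q0; have : 2 < #|Q :\ q0| by move: Q_gt3; rewrite (cardsD1 q0 Q) Q0.
case/card_gt2P=> q1 [q2 [q3 []]]; rewrite !inE.
move=> [/andP[q10 Q1] /andP[q20 Q2] /andP[q30 Q3]] [q12 q23 q31].
exists q1, q2, q3; split; [by [] | split; split; try by apply: blueQ; rewrite // eq_sym].
rewrite /= !inE !negb_or (eq_sym q0 q1) q10 (eq_sym q0 q2) q20 (eq_sym q0 q3) q30.
by rewrite q12 (eq_sym q1 q3) q31 q23.
Qed.

Let neAQ a q : a \in A -> q \in Q -> a != q.
Proof. by move=> aA qQ; rewrite eq_sym neQA. Qed.
Let neUQ u q : u \in U -> q \in Q -> u != q.
Proof. by move=> uU qQ; rewrite eq_sym neQU. Qed.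
Let blueQU q u : q \in Q -> u \in U -> blue q u.
Proof. by move=> *; rewrite blue_sym blueUQ. Qed.

Let not_red a q : a \in A -> q \in Q -> ~~ red a q -> blue a q.
Proof. by move=> aA qQ nr; rewrite /blue neAQ. Qed.

(** If [a] were blue to three vertices [q1, q2, q3] of [Q] other than [q0], then
    [a, q1, u1, q0, u2, q2] would be the rim of a wheel with hub [q3]. *)
Lemma unattached_pair a u1 u2 q0 : a \in A -> u1 \in U -> u2 \in U -> u1 != u2 ->
  q0 \in Q -> exists2 q, q \in Q & (q != q0) && red a q.
Proof.
move=> aA U1 U2 u12 Q0; apply/exists_inP; apply: contraT; rewrite negb_exists_in.
move=> /forall_inP none.
have [q1 [q2 [q3 [[Q1 Q2 Q3] [[uq b01 b02 b03] [b12 b23 b31]]]]]] := three_others Q0.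
have ba q : q \in Q -> q != q0 -> blue a q.
  by move=> qQ q0q; apply: not_red => //; have := none q qQ; rewrite q0q.
move: uq; rewrite /= !inE !negb_or => /and4P[/and3P[q01 q02 q03] /andP[q12 q13] q23 _].
have [ba1 ba2 ba3] : [/\ blue a q1, blue a q2 & blue a q3].
  by split; apply: ba; rewrite // eq_sym.
case: (nowheel (h := q3) (s := [:: a; q1; u1; q0; u2; q2])) => //.
- rewrite /= !inE !negb_or (neAQ aA Q1) (neAU aA U1) (neAQ aA Q0) (neAU aA U2) (neAQ aA Q2).
  rewrite (neQU Q1 U1) (eq_sym q1 q0) q01 (neQU Q1 U2) q12 (neUQ U1 Q0) u12 (neUQ U1 Q2).
  by rewrite (neQU Q0 U2) q02 (neUQ U2 Q2).
- rewrite /= (blue_sym q3 a) ba3 b31 (blueQU Q3 U1) (blue_sym q3 q0) b03.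
  by rewrite (blueQU Q3 U2) (blue_sym q3 q2) b23.
- rewrite /= ba1 (blueQU Q1 U1) (blueUQ U1 Q0) (blueQU Q0 U2) (blueUQ U2 Q2).
  by rewrite (blue_sym q2) ba2.
Qed.

Hypothesis attached : forall a, a \in A -> exists2 q, q \in Q & red a q.
Hypothesis no_link : forall a b p q, a \in A -> b \in A -> red a b ->
  p \in Q -> q \in Q -> red a p -> red b q -> p = q.

Let cardA : 4 < #|A|. Proof. by lia. Qed.

Let red_neighbour a b : a \in A -> b \in A ->
  exists d, [/\ d \in A, d != b & red a d].
Proof.
move=> aA bA; have [|d [dA ds da _]] := @ex_avoid _ A (blue_nbrs red A a) set0 [:: a; b].
  rewrite cards0 addn0 /=; apply: leq_ltn_trans cardA.
  by rewrite -[4]/(2 + 2) leq_add2l blueA.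
move: ds; rewrite !inE negb_or => /andP[da' db]; exists d; split=> //.
exact: (@not_blue_nbr _ _ A).
Qed.

(** Red neighbours in [A] see the same single vertex of [Q].  The red graph on [A]
    has diameter at most two: two vertices that are blue to each other exclude at
    most two further vertices as common red neighbours.  So the vertex of [Q] is
    the same for all of [A]. *)
Lemma common_attachment : exists q0, [/\ q0 \in Q,
  forall a, a \in A -> red a q0 & forall a q, a \in A -> q \in Q -> q != q0 -> blue a q].
Proof.
have /card_gt0P[a0 A0] : 0 < #|A| by lia.
have [q0 Q0 aq0] := attached A0.
have near b q : b \in A -> red b a0 -> q \in Q -> red b q -> q = q0.
  by move=> bA ba qQ bq; apply: (no_link bA A0 ba).
have all_q0 a q : a \in A -> q \in Q -> red a q -> q = q0.
  move=> aA qQ aq; case ra: (red a a0); first exact: (near a).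
  have [aE|ne] := eqVneq a a0.
    have [b [bA _ ab]] := red_neighbour aA aA; have [p pQ bp] := attached bA.
    rewrite (no_link aA bA ab qQ pQ aq bp).
    by apply: (near b) => //; rewrite -aE red_sym.
  have [|b] := @ex_out _ A (blue_nbrs red A a :|: blue_nbrs red A a0).
    have ba : a0 \in blue_nbrs red A a by rewrite inE A0 /blue ne ra.
    have ab : a \in blue_nbrs red A a0 by rewrite inE aA /blue eq_sym ne red_sym ra.
    have [h _] := leq_card_setU (blue_nbrs red A a) (blue_nbrs red A a0).
    by apply: leq_ltn_trans h _; apply: leq_ltn_trans cardA; rewrite -[4]/(2 + 2) leq_add ?blueA.
  move=> bA; rewrite inE negb_or => /andP[nb nb0].
  have ba : b != a by apply: contraNneq nb0 => ->; rewrite inE aA /blue eq_sym ne red_sym ra.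
  have ba0 : b != a0 by apply: contraNneq nb => ->; rewrite inE A0 /blue ne ra.
  have ab := not_blue_nbr bA ba nb; have a0b := not_blue_nbr bA ba0 nb0.
  have [p pQ bp] := attached bA; rewrite (no_link aA bA ab qQ pQ aq bp).
  by apply: (near b) => //; rewrite red_sym.
exists q0; split=> // [a aA|a q aA qQ].
  by have [q qQ aq] := attached aA; rewrite -(all_q0 a q).
by move=> qq0; apply: not_red => //; apply: contra qq0 => /(all_q0 a q aA qQ) ->.
Qed.

(** All of [A] is red to some [q0] and blue to the rest of [Q].  So two vertices in
    [U] would contradict [unattached_pair]; a single one, [z], has at most two blue
    neighbours in [A] and forces [A] to be a red clique.  In either case [A] and [U]
    together have at most two blue neighbours at each vertex, and a red path
    through all their [m] vertices with ends in [A] closes at [q0]. *)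
Lemma attachment_absurd : False.
Proof.
have [q0 [Q0 aq0 baq]] := common_attachment.
have [q1 [q2 [q3 [[Q1 Q2 Q3] [[uq b01 b02 b03] [b12 b23 b31]]]]]] := three_others Q0.
move: uq; rewrite /= !inE !negb_or => /and4P[/and3P[q01 q02 q03] /andP[q12 q13] q23 _].
have ba q a : q \in Q -> q0 != q -> a \in A -> blue a q.
  by move=> qQ q0q aA; apply: baq; rewrite // eq_sym.
have cardA0 : 0 < #|A| by apply: leq_trans cardA.
have /card_gt0P[a0 A0] := cardA0.
have U1 : #|U| <= 1.
  rewrite leqNgt; apply/negP => /card_gt1P[u1 [u2 [U1 U2 u12]]].
  have [q qQ /andP[qq0 aq]] := unattached_pair A0 U1 U2 u12 Q0.
  by have := baq a0 q A0 qQ qq0; rewrite /blue aq andbF.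
have blueAU w : w \in A :|: U -> #|blue_nbrs red (A :|: U) w| <= 2.
  have [->|[z zU]] : U = set0 \/ exists z, z \in U.
    by case: (set_0Vmem U) => [->|[z]]; [left | right; exists z].
  - by rewrite setU0; apply: blueA.
  have Uz : U = [set z].
    apply/eqP; rewrite eq_sym eqEcard sub1set zU cards1; exact: U1.
  have clique a b : a \in A -> b \in A -> ~~ blue a b.
    move=> aA bA; apply/negP => ab; have ne : a != b by case/andP: ab.
    case: (nowheel (h := q3) (s := [:: q2; a; b; q1; z; q0])) => //.
    + rewrite /= !inE !negb_or ne (neQA Q2 aA) (neQA Q2 bA) (eq_sym q2 q1) q12.
      rewrite (neQU Q2 zU) (eq_sym q2 q0) q02 (neAQ aA Q1) (neAU aA zU) (neAQ aA Q0).
      rewrite (neAQ bA Q1) (neAU bA zU) (neAQ bA Q0) (neQU Q1 zU) (eq_sym q1 q0) q01.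
      by rewrite (neUQ zU Q0).
    + rewrite /= (blue_sym q3 q2) b23 (blue_sym q3 a) (ba q3 a) //.
      by rewrite (blue_sym q3 b) (ba q3 b) // b31 (blueQU Q3 zU) (blue_sym q3 q0) b03.
    + rewrite /= (blue_sym q2 a) (ba q2 a) // ab (ba q1 b) // (blueQU Q1 zU).
      by rewrite (blueUQ zU Q0) b02.
  rewrite inE Uz => /orP[wA|/set1P->].
    apply: leq_trans (_ : #|[set z]| <= _); last by rewrite cards1.
    apply/subset_leq_card/subsetP => b; rewrite !inE => /andP[/orP[bA|//] wb].
    by have := clique w b wA bA; rewrite wb.
  rewrite leqNgt; apply/negP => z3.
  apply: (@no_wheel_triples _ _ red_sym z (blue_nbrs red (A :|: [set z]) z) (Q :\ q0)) => //.
  - by have := Q_gt3; rewrite (cardsD1 q0 Q) Q0.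
  - by move=> s; rewrite inE => /andP[].
  - by move=> q; rewrite !inE => /andP[_ qQ]; apply: blueUQ.
  move=> s q; rewrite !inE => /andP[/orP[sA _|/eqP-> zz]] /andP[qq0 qQ].
    exact: baq.
  exact: blueUQ.
have cardAU' : #|A :|: U| = m.
  by rewrite -cardAU; apply/eqP; rewrite (leq_card_setU A U).
have /card_gt1P[a1 [a2 [A1 A2 a12]]] : 1 < #|A| by apply: leq_trans cardA.
have p : rpath red (A :|: U) a1 a2 m.
  by apply: panconnected; rewrite ?inE ?A1 ?A2 ?cardAU' // leqnn andbT; apply: leq_trans m_gt6.
apply: (rpath_cycle nocycle (rpath_one red q0) p) => //.
- by rewrite red_sym aq0.
- exact: aq0.
- by rewrite disjoints1 inE negb_or (disjointFr dQA) ?(disjointFr dQU).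
Qed.
End Attachment.

(** * Three red neighbours on the cycle *)

Section ThreeNeighbours.
Variables (V : finType) (red : rel V).
Hypotheses (red_sym : symmetric red) (red_irr : irreflexive red).
Variables (m : nat) (c : nat -> V).
Hypotheses (cC : cyclic red m c) (m_gt6 : 6 < m) (cardV : #|V| = m.*2.+1).
Hypotheses (nocycle : no_cycle red m.+1) (nowheel : no_wheel red).
Local Notation blue := (blue red).
Local Notation rpath := (rpath red).
Local Notation carrier := (carrier m c).
Local Notation blue_sym := (blue_sym red_sym).
Variable x : V.
Hypothesis xC : x \notin carrier.

Let m_gt2 : 2 < m. Proof. by lia. Qed.
Let cP i : c (i + m) = c i. Proof. by case: cC. Qed.
Let cR i : red (c i) (c i.+1). Proof. by case: cC. Qed.
Let cI a i j : a <= i < a + m -> a <= j < a + m -> c i = c j -> i = j.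
Proof. by case: cC => _ _; apply. Qed.
Let arcC a b : a <= b < a + m -> forall k, k = b.+1 - a -> rpath (arc c a b) (c a) (c b) k.
Proof. by move=> ab k; apply: (arc_rpath cC). Qed.
Let arcCr a b : a <= b < a + m -> forall k, k = b.+1 - a -> rpath (arc c a b) (c b) (c a) k.
Proof. by move=> ab k kE; apply/(rpath_rev red_sym)/arcC. Qed.
Let carrier_c i : c i \in carrier. Proof. exact: (mem_carrier cC). Qed.
Let no_consec := no_consecutive red_sym cC m_gt2 nocycle.

Lemma neighbour_gap s t : s < t < s + m -> red x (c s) -> red x (c t) -> s.+2 <= t <= s + m - 2.
Proof.
move=> st xs xt; have := no_consec xC xs; have := no_consec xC xt => nt ns.
have nst : s.+1 != t by apply: contraNneq ns => ->.
have nts : t.+1 != s + m by apply: contraNneq nt => ->; rewrite cP.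
by lia.
Qed.

(** Includes the case [s = t], where the two neighbours of [y] would be
    consecutive. *)
Lemma shifted_far y s t : y \notin carrier -> y != x -> s <= t < s + m ->
  red x (c s) -> red x (c t) -> red y (c s.+1) -> ~~ red y (c t.+2).
Proof.
move=> yC yx /andP[]; rewrite leq_eqVlt => /predU1P [-> _ _ _|st tm xs xt].
  exact: (no_consec yC).
have := @neighbour_gap s t; rewrite st tm => /(_ isT xs xt) gap.
by apply: (shifted_neighbours red_sym cC m_gt2 nocycle xC yC yx st) => //; lia.
Qed.

Variables i j l : nat.
Hypotheses (ij : i < j) (jl : j < l) (li : l < i + m).
Hypotheses (xi : red x (c i)) (xj : red x (c j)) (xl : red x (c l)).

Let gij : i.+2 <= j. Proof. by have := @neighbour_gap i j; rewrite ij xi xj; lia. Qed.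
Let gjl : j.+2 <= l. Proof. by have := @neighbour_gap j l; rewrite jl xj xl; lia. Qed.
Let gli : l.+2 <= i + m.
Proof. by have := @neighbour_gap i l; rewrite xi xl li; lia. Qed.
Let xim : red x (c (i + m)). Proof. by rewrite cP. Qed.
Let xjm : red x (c (j + m)). Proof. by rewrite cP. Qed.

(** The blue clique. *)
Definition succs := [set x; c i.+1; c j.+1; c l.+1].
(** The cycle and [x]: the red paths between vertices of [succs] are taken here. *)
Definition spine := x |: carrier.
Definition attached := [set z in ~: spine | [exists q in succs, red z q]].
Definition unattached := ~: spine :\: attached.

Lemma succsP (R : V -> Prop) : R x -> R (c i.+1) -> R (c j.+1) -> R (c l.+1) ->
  forall q, q \in succs -> R q.
Proof. by move=> ? ? ? ? q; rewrite !inE -!orbA => /or4P[] /eqP->. Qed.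

Lemma succs_pairs (R : V -> V -> Prop) : (forall p q, R p q -> R q p) ->
  R x (c i.+1) -> R x (c j.+1) -> R x (c l.+1) ->
  R (c i.+1) (c j.+1) -> R (c j.+1) (c l.+1) -> R (c i.+1) (c l.+1) ->
  forall p q, p \in succs -> q \in succs -> p != q -> R p q.
Proof.
move=> Rs xi' xj' xl' ij' jl' il' p q; rewrite !inE -!orbA.
by case/or4P=> /eqP-> /or4P[] /eqP-> //; rewrite ?eqxx // => _; apply: Rs.
Qed.

Lemma xNc t : x != c t. Proof. by apply: contraNneq xC => ->. Qed.

Lemma succs_spine q : q \in succs -> q \in spine.
Proof. by move: q; apply: succsP; rewrite !inE ?eqxx // carrier_c orbT. Qed.

Lemma cNc s t : s < t < s + m -> c s != c t.
Proof. by move=> st; apply/eqP => /(@cI s); lia. Qed.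

Lemma card_succs : #|succs| = 4.
Proof.
have -> : succs = [set y in [:: x; c i.+1; c j.+1; c l.+1]].
  by apply/setP => y; rewrite !inE -!orbA.
rewrite cardsE; apply/card_uniqP; rewrite /= !inE !negb_or !xNc /=.
by rewrite !cNc //; lia.
Qed.

Lemma blue_succs p q : p \in succs -> q \in succs -> p != q -> blue p q.
Proof.
have bx s : red x (c s) -> blue x (c s.+1).
  by move=> xs; rewrite /blue xNc no_consec.
have bc s t : s < t < s + m -> red x (c s) -> red x (c t) -> blue (c s.+1) (c t.+1).
  move=> st xs xt; rewrite /blue cNc /=; last by lia.
  exact: (successors_blue red_sym cC m_gt2 nocycle xC).
move: p q; apply: succs_pairs => [p q||||||]; first by rewrite blue_sym.
1-3: by apply: bx.
all: by apply: bc; rewrite ?ij ?jl ?li //; lia.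
Qed.

Lemma card_off_spine : #|~: spine| = m.
Proof.
have := cardsC spine; rewrite cardV /spine cardsU1 xC (card_carrier cC m_gt2).
by move=> H; apply/eqP; rewrite -(eqn_add2l m.+1) -{1}add1n H addSn addnn.
Qed.

Lemma off_spineP z : z \in ~: spine -> z \notin carrier /\ z != x.
Proof. by rewrite !inE negb_or => /andP[]. Qed.

Lemma attachedP a : a \in attached -> [/\ a \notin carrier, a != x & exists2 q, q \in succs & red a q].
Proof. by rewrite inE => /andP[/off_spineP [aC ax] /exists_inP]. Qed.

(** By rerouting the cycle through [x] and [a]; the vertices of [succs] are shifted
    by one from the neighbours of [x], so that the excluded ones are shifted by
    two. *)
Lemma attached_blue a : a \in attached ->
  [/\ blue a (c i.+2), blue a (c j.+2) & blue a (c l.+2)].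
Proof.
have [ii iJ iL] : [/\ i <= i < i + m, i <= j < i + m & i <= l < i + m] by split; lia.
have [jI jJ jL] : [/\ j <= i + m < j + m, j <= j < j + m & j <= l < j + m] by split; lia.
have [lI lJ lL] : [/\ l <= i + m < l + m, l <= j + m < l + m & l <= l < l + m].
  by split; lia.
case/attachedP=> aC ax [q qQ aq].
have aNc t : a != c t by apply: contraNneq aC => ->.
have far s t : s <= t < s + m -> red x (c s) -> red x (c t) -> red a (c s.+1) ->
    blue a (c t.+2).
  by move=> st xs xt as'; rewrite /blue aNc (shifted_far aC ax st xs xt as').
have farm s t : s <= t + m < s + m -> red x (c s) -> red x (c t) -> red a (c s.+1) ->
    blue a (c t.+2).
  by rewrite -(cP t) -(cP t.+2) !addSn; apply: far.
move: q qQ aq; apply: succsP => aq.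
- have nx t : red x (c t) -> blue a (c t.+2).
    move=> xt; rewrite /blue aNc.
    by apply: (red_pair_distance red_sym red_irr cC m_gt2 nocycle xC aC) => //; rewrite red_sym.
  by split; apply: nx.
- by split; apply: (far i).
- by split; [apply: (farm j) | apply: (far j) | apply: (far j)].
- by split; [apply: (farm l) | apply: (farm l) | apply: (far l)].
Qed.

(** Three blue neighbours would alternate with [c i.+2], [c j.+2], [c l.+2] on the
    rim of a wheel. *)
Lemma attached_blue_nbrs a : a \in attached -> #|blue_nbrs red attached a| <= 2.
Proof.
move=> aA; rewrite leqNgt; apply/negP => a3.
have cardP : 2 < #|[set y in [:: c i.+2; c j.+2; c l.+2]]|.
  rewrite cardsE (card_uniqP _) //= !inE !negb_or !cNc //; lia.
have bP b p : b \in attached -> p \in [set y in [:: c i.+2; c j.+2; c l.+2]] -> blue b p.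
  by move=> /attached_blue [b1 b2 b3]; rewrite !inE => /or3P[] /eqP->.
apply: (no_wheel_triples (h := a) red_sym nowheel a3 cardP) => [s|t|s t].
- by rewrite inE => /andP[].
- exact: bP.
- by rewrite [s \in _]inE => /andP[sA _]; apply: bP.
Qed.

Lemma unattached_blue u q : u \in unattached -> q \in succs -> blue u q.
Proof.
rewrite !in_setD => /andP[uA uZ] qQ; have qD := succs_spine qQ.
rewrite /blue; apply/andP; split.
  by apply: contraTneq uZ => ->; rewrite in_setC qD.
by apply: contra uA => uq; rewrite inE uZ; apply/exists_inP; exists q.
Qed.

(** Three of them would alternate with the other vertices of [succs] on the rim of a
    wheel with hub [x]. *)
Lemma card_unattached : #|unattached| <= 2.
Proof.
rewrite leqNgt; apply/negP => u3.
have xQ : x \in succs by rewrite !inE eqxx.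
have Q3 : 2 < #|succs :\ x| by have := card_succs; rewrite (cardsD1 x succs) xQ add1n => -[->].
apply: (no_wheel_triples (h := x) red_sym nowheel u3 Q3) => [u uU|q|u q uU].
- by rewrite blue_sym unattached_blue.
- by rewrite in_setD1 => /andP[qx qQ]; apply: blue_succs; rewrite // eq_sym.
- by rewrite in_setD1 => /andP[_]; apply: unattached_blue.
Qed.

Lemma attached_sub : attached \subset ~: spine. Proof. by apply/subsetP => a; rewrite inE => /andP[]. Qed.

Lemma card_attachedU : #|attached| + #|unattached| = m.
Proof. by rewrite -card_off_spine -(cardsID attached (~: spine)) (setIidPr attached_sub). Qed.

Lemma disjoint_spine (S : {set V}) : S \subset ~: spine -> [disjoint spine & S].
Proof. by rewrite disjoint_sym disjoints_subset. Qed.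

Lemma no_link_absurd : (forall a b p q, a \in attached -> b \in attached -> red a b ->
  p \in succs -> q \in succs -> red a p -> red b q -> p = q) -> False.
Proof.
have outU : unattached \subset ~: spine by apply: subsetDl.
have succsS : succs \subset spine by apply/subsetP/succs_spine.
move=> nolink.
apply: (@attachment_absurd V red red_sym m nocycle nowheel m_gt6 succs attached unattached) => //.
- by rewrite card_succs.
- exact: card_attachedU.
- exact: card_unattached.
- by apply: disjointWl succsS (disjoint_spine attached_sub).
- by apply: disjointWl succsS (disjoint_spine outU).
- by rewrite disjoint_sym disjoints_subset /unattached setDE subsetIr.
- exact: blue_succs.
- exact: unattached_blue.
- exact: attached_blue_nbrs.
- by move=> a /attachedP[].
Qed.

Lemma linked_cycle (S : {set V}) a b p q k k' : S \subset ~: spine -> rpath S a b k -> rpath spine p q k' ->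
  red a p -> red b q -> k + k' = m.+1 -> False.
Proof.
move=> SZ rab rpq ap bq kk.
apply: (rpath_cycle nocycle rpq (rpath_rev red_sym rab)); rewrite ?(red_sym q) //.
  exact: disjoint_spine.
by rewrite addnC.
Qed.

(** A red edge between attached vertices closes a cycle with a path of [m - 1]
    vertices. *)
Lemma short_links_absurd :
  (forall p q, p \in succs -> q \in succs -> p != q -> rpath spine p q m.-1) -> False.
Proof.
have m2 : 2 + m.-1 = m.+1 by lia.
move=> short; apply: no_link_absurd => a b p q aA bA ab pQ qQ ap bq.
apply/eqP; apply: contraT => pq; exfalso.
apply: (linked_cycle _ (rpath_edge red_irr ab) (short p q pQ qQ pq) ap bq) => //.
by apply/subsetP => y /set2P[] ->; apply: (subsetP attached_sub).
Qed.

(** Panconnectedness supplies the complement to any path in [spine] that is not too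
    long. *)
Lemma long_links_absurd : 6 < #|attached| ->
  (forall p q, p \in succs -> q \in succs -> p != q -> exists2 k, 5 <= k <= m - 2 &
     rpath spine p q (m.+1 - k)) -> False.
Proof.
have le_A k : 5 <= k <= m - 2 -> 5 <= k <= #|attached|.
  by have := card_attachedU; have := card_unattached; lia.
have len k : 5 <= k <= m - 2 -> k + (m.+1 - k) = m.+1 by lia.
move=> A7 long; apply: no_link_absurd => a b p q aA bA ab pQ qQ ap bq.
apply/eqP; apply: contraT => pq; exfalso; have [k k5 rpq] := long p q pQ qQ pq.
have a_b : a != b by apply: contraTneq ab => ->; rewrite red_irr.
have rab : rpath attached a b k.
  apply: panconnected => //; first exact: attached_blue_nbrs.
  exact: le_A.
by apply: (linked_cycle attached_sub rab rpq ap bq); apply: len.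
Qed.

Lemma arc_spine a b : arc c a b \subset spine.
Proof. by apply: subset_trans (arc_sub cC m_gt2 a b) (subsetUr _ _). Qed.

Lemma x_arc_spine a b : x |: arc c a b \subset spine.
Proof. by apply: setUS; apply: (arc_sub cC m_gt2). Qed.

Lemma rpath_x a b s t k : rpath (arc c a b) (c s) (c t) k -> red x (c s) -> rpath spine x (c t) k.+1.
Proof.
move=> r xs; apply: rpath_sub (x_arc_spine a b) _.
by apply: (rpath_cat (rpath_one red x) r xs); apply: (outside_arc cC m_gt2 xC).
Qed.

Lemma long_x s : red x (c s) -> exists2 k, 5 <= k <= m - 2 & rpath spine x (c s.+1) (m.+1 - k).
Proof.
move=> xs; exists (m - 2); first by lia.
have -> : m.+1 - (m - 2) = 3 by lia.
by apply: (rpath_x (a := s) (b := s.+1)) xs; apply: arcC; lia.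
Qed.

(** One of the two arcs between [c s.+1] and [c t.+1] has at least half of the
    vertices of the cycle.  The complementary length is then in the range of
    [panconnected], except for antipodal vertices of an octagon. *)
Lemma long_pair s t : s.+2 <= t <= s + m - 2 -> 8 < m \/ 7 < m /\ t - s != 4 ->
  exists2 k, 5 <= k <= m - 2 & rpath spine (c s.+1) (c t.+1) (m.+1 - k).
Proof.
move=> st m8; have [near|far] := leqP (t - s) (m - 5).
  exists (m - (t - s)); first by lia.
  by apply: rpath_sub (arc_spine s.+1 t.+1) _; apply: arcC; lia.
exists (t - s); first by lia.
apply: rpath_sub (arc_spine t.+1 (s.+1 + m)) _; rewrite -(cP s.+1).
by apply: arcCr; lia.
Qed.

Lemma long_case : 6 < #|attached| ->
  8 < m \/ 7 < m /\ [/\ j - i != 4, l - j != 4 & l - i != 4] -> False.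
Proof.
move=> A7 m8; apply: (long_links_absurd A7); apply: succs_pairs.
- by move=> p q [k k5 r]; exists k => //; apply: rpath_rev.
- exact: long_x.
- exact: long_x.
- exact: long_x.
- by apply: long_pair; [lia | case: m8 => [|[? []]]; auto].
- by apply: long_pair; [lia | case: m8 => [|[? []]]; auto].
- by apply: long_pair; [lia | case: m8 => [|[? []]]; auto].
Qed.

(** With neighbours at distances two and two, paths in [spine] with [m - 1]
    vertices are found explicitly. *)
Lemma short_case : j = i.+2 -> l = i.+4 -> False.
Proof.
move=> jE lE; apply: short_links_absurd; apply: succs_pairs.
- by move=> p q; apply: rpath_rev.
- rewrite (_ : m.-1 = (m - 2).+1); last by lia.
  apply: (rpath_x (a := l) (b := i.+1 + m)) xl.
  by rewrite -(cP i.+1); apply: arcC; lia.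
- rewrite (_ : m.-1 = (m - 2).+1); last by lia.
  by apply: (rpath_x (a := j.+1) (b := i + m)) xim; apply: arcCr; lia.
- rewrite (_ : m.-1 = (m - 2).+1); last by lia.
  by apply: (rpath_x (a := l.+1) (b := j + m)) xjm; apply: arcCr; lia.
- apply: rpath_sub (arc_spine j.+1 (i.+1 + m)) _; rewrite -(cP i.+1).
  by apply: arcCr; lia.
- apply: rpath_sub (arc_spine l.+1 (j.+1 + m)) _; rewrite -(cP j.+1).
  by apply: arcCr; lia.
have r1 : rpath (arc c i.+1 j) (c i.+1) (c j) 2 by apply: arcC; lia.
have r2 : rpath (arc c l.+1 (i + m)) (c (i + m)) (c l.+1) (m - 4) by apply: arcCr; lia.
have r3 := rpath_cat (rpath_one red x) r2 xim (outside_arc cC m_gt2 xC _ _).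
rewrite (_ : m.-1 = 2 + (1 + (m - 4))); last by lia.
have sub : arc c i.+1 j :|: (x |: arc c l.+1 (i + m)) \subset spine.
  by rewrite subUset arc_spine x_arc_spine.
apply: rpath_sub sub _; apply: (rpath_cat r1 r3); first by rewrite red_sym.
rewrite disjoint_setUr (disjoint_sym (arc _ _ _)) (outside_arc cC m_gt2 xC) andTb.
by apply: (@arc_disjoint V red m c cC m_gt2 i.+1); lia.
Qed.

Lemma eight_links : m = 8 -> j = i.+2 -> l = i + 5 ->
  (forall q, q \in succs -> q != c j.+1 -> rpath spine (c j.+1) q 7) /\
  (forall p q, p \in succs -> q \in succs -> p != q -> p != c j.+1 -> q != c j.+1 ->
     rpath spine p q 6).
Proof.
move=> m8 jE lE; split.
  apply: succsP => [|||]; rewrite ?eqxx // => _.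
  - apply/(rpath_rev red_sym)/(rpath_x (a := j.+1) (b := i + m) (s := i + m)) => //.
    by apply: arcCr; lia.
  - apply: rpath_sub (arc_spine j.+1 (i.+1 + m)) _; rewrite -(cP i.+1).
    by apply: arcC; lia.
  have r1 : rpath (arc c j.+1 l) (c j.+1) (c l) 3 by apply: arcC; lia.
  have r2 : rpath (arc c l.+1 (i + m)) (c (i + m)) (c l.+1) 3 by apply: arcCr; lia.
  have r3 := rpath_cat (rpath_one red x) r2 xim (outside_arc cC m_gt2 xC _ _).
  have sub : arc c j.+1 l :|: (x |: arc c l.+1 (i + m)) \subset spine.
    by rewrite subUset arc_spine x_arc_spine.
  apply: rpath_sub sub _; apply: (rpath_cat r1 r3); first by rewrite red_sym.
  rewrite disjoint_setUr (disjoint_sym (arc _ _ _)) (outside_arc cC m_gt2 xC) andTb.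
  by apply: (@arc_disjoint V red m c cC m_gt2 j.+1); lia.
apply: succs_pairs; rewrite ?eqxx //.
  - move=> p q r nq np; apply: rpath_rev => //; exact: r.
  - move=> _ _; apply: (rpath_x (a := l) (b := i.+1 + m)) xl.
    by rewrite -(cP i.+1); apply: arcC; lia.
  - move=> _ _; apply: (rpath_x (a := j) (b := l.+1)) xj.
    by apply: arcC; lia.
  - move=> _ _; apply: rpath_sub (arc_spine i.+1 l.+1) _; apply: arcC; lia.
Qed.

(** With seven attached vertices this is an instance of [long_case].  With six,
    there are two unattached vertices, so each attached vertex has two red
    neighbours in [succs].  A red edge between attached vertices and a path of
    seven vertices would close a cycle if one of them saw [c j.+1]; so none does, and
    three attached vertices on a path are combined with the paths of six vertices
    between the other vertices of [succs]. *)
Lemma eight_case : m = 8 -> j = i.+2 -> l = i + 5 -> False.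
Proof.
move=> m8 jE lE; have [seven six] := eight_links m8 jE lE.
have [A7|A6] := ltnP 6 #|attached|.
  by apply: (long_case A7); right; split; [lia | split; lia].
have A6' : 5 < #|attached| by have := card_attachedU; have := card_unattached; lia.
have /card_gt1P[u1 [u2 [U1 U2 u12]]] : 1 < #|unattached| by have := card_attachedU; lia.
have two a q0 : a \in attached -> q0 \in succs -> exists2 q, q \in succs & (q != q0) && red a q.
  move=> aA Q0; have outU : unattached \subset ~: spine by apply: subsetDl.
  have succsS : succs \subset spine by apply/subsetP/succs_spine.
  apply: (unattached_pair red_sym nowheel _ _ _ _ blue_succs unattached_blue aA U1 U2 u12 Q0).
  - by rewrite card_succs.
  - by apply: disjointWl succsS (disjoint_spine attached_sub).
  - by apply: disjointWl succsS (disjoint_spine outU).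
  - by rewrite disjoint_sym disjoints_subset /unattached setDE subsetIr.
have q3Q : c j.+1 \in succs by rewrite !inE eqxx !orbT.
have nbrs a s : a \in attached -> size s <= 1 -> exists b, [/\ b \in attached, b \notin s & red a b].
  move=> aA s1; have [|b [bA bs ba _]] := @ex_avoid _ attached (blue_nbrs red attached a) set0 (a :: s).
    rewrite cards0 addn0 /=; apply: leq_ltn_trans (leq_add (_ : _ <= 2) (attached_blue_nbrs aA)) _.
      by [].
    exact: ltnW.
  move: bs; rewrite inE negb_or => /andP[b_a bs].
  by exists b; split=> //; apply: not_blue_nbr bA b_a ba.
have not3 a : a \in attached -> ~~ red a (c j.+1).
  move=> aA; apply/negP => a3; have [//|b [bA _ ab]] := nbrs a [::] aA.
  have [q qQ /andP[q3 bq]] := two b _ bA q3Q.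
  apply: (linked_cycle _ (rpath_edge red_irr ab) (seven q qQ q3) a3 bq); last by rewrite m8.
  by apply/subsetP => y /set2P[] ->; apply: (subsetP attached_sub).
have /card_gt0P[a aA] : 0 < #|attached| by apply: leq_trans A6'.
have [//|b [bA _ ab]] := nbrs a [::] aA.
have [//|d [dA]] := nbrs a [:: b] aA; rewrite inE => db ad.
have [p pQ /andP[_ bp]] := two b (c j.+1) bA q3Q.
have [q qQ /andP[qp dq]] := two d p dA pQ.
have p3 : p != c j.+1 by apply: contraTneq bp => ->; apply: not3.
have q3 : q != c j.+1 by apply: contraTneq dq => ->; apply: not3.
have r : rpath (b |: [set a; d]) b d 3.
  apply: (rpath_cat (rpath_one red b) (rpath_edge red_irr ad)); first by rewrite red_sym.
  rewrite disjoints1 !inE negb_or (eq_sym b d) db andbT.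
  by apply: contraTneq ab => ->; rewrite red_irr.
rewrite eq_sym in qp.
apply: (linked_cycle _ r (six p q pQ qQ qp p3 q3) bp dq); last by rewrite m8.
by apply/subsetP => y /setU1P [->|/set2P[] ->]; apply: (subsetP attached_sub).
Qed.
End ThreeNeighbours.

Section AtMostTwo.
Variables (V : finType) (red : rel V).
Hypotheses (red_sym : symmetric red) (red_irr : irreflexive red).
Variables (m : nat) (c : nat -> V).
Hypotheses (cC : cyclic red m c) (m_gt6 : 6 < m) (cardV : #|V| = m.*2.+1).
Hypotheses (nocycle : no_cycle red m.+1) (nowheel : no_wheel red).
Local Notation carrier := (carrier m c).

(** The gaps between the three neighbours are at least two.  If [m >= 9] this is
    enough; up to rotation they are (2, 2, 3) if [m = 7], and (2, 2, 4) or (2, 3, 3)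
    if [m = 8]. *)
Lemma no_three_neighbours x i j l : x \notin carrier -> i < j -> j < l -> l < i + m ->
  red x (c i) -> red x (c j) -> red x (c l) -> False.
Proof.
move=> xC ij jl li xi xj xl.
have cP k : c (k + m) = c k by case: cC.
have xP k : red x (c k) -> red x (c (k + m)) by rewrite cP.
have gap := neighbour_gap red_sym cC m_gt6 cardV nocycle xC.
have g1 : i.+2 <= j by have := gap i j; rewrite ij xi xj; lia.
have g2 : j.+2 <= l by have := gap j l; rewrite jl xj xl; lia.
have g3 : l.+2 <= i + m by have := gap i l; rewrite xi xl li; lia.
clear gap.
pose short := short_case red_sym red_irr cC m_gt6 cardV nocycle nowheel xC.
pose eight := eight_case red_sym red_irr cC m_gt6 cardV nocycle nowheel xC.
pose long := long_case red_sym red_irr cC m_gt6 cardV nocycle nowheel xC.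
have [m9|m8] := ltnP 8 m.
  apply: (long i j l ij jl li xi xj xl); last by left.
  have := card_attachedU cC m_gt6 cardV xC i j l.
  have := card_unattached red_sym cC m_gt6 cardV nocycle nowheel xC ij jl li xi xj xl.
  by clear -m9; lia.
have [m7|m8'] : m = 7 \/ m = 8 by lia.
  have [[jE lE]|[[jE lE]|[jE lE]]] : (j = i.+2 /\ l = i.+4) \/
      (j = i.+2 /\ l = i + 5) \/ (j = i + 3 /\ l = i + 5) by lia.
  - exact: (short i j l).
  - by apply: (short l (i + m) (j + m)); rewrite ?cP //; lia.
  - by apply: (short j l (i + m)); rewrite ?cP //; lia.
have [[jE lE]|[[jE lE]|[[jE lE]|[[jE lE]|[[jE lE]|[jE lE]]]]]] :
    (j = i.+2 /\ l = i.+4) \/ (j = i.+2 /\ l = i + 6) \/ (j = i + 4 /\ l = i + 6) \/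
    (j = i.+2 /\ l = i + 5) \/ (j = i + 3 /\ l = i + 6) \/ (j = i + 3 /\ l = i + 5).
  by lia.
- exact: (short i j l).
- by apply: (short l (i + m) (j + m)); rewrite ?cP //; lia.
- by apply: (short j l (i + m)); rewrite ?cP //; lia.
- exact: (eight i j l).
- by apply: (eight l (i + m) (j + m)); rewrite ?cP //; lia.
- by apply: (eight j l (i + m)); rewrite ?cP //; lia.
Qed.

Lemma few_neighbours x : x \notin carrier -> #|red_nbrs red carrier x| <= 2.
Proof.
move=> xC; rewrite leqNgt; apply/negP => /card_gt2P[y1 [y2 [y3 []]]].
rewrite !inE => -[/andP[/imsetP[i _ ->] xi] /andP[/imsetP[j _ ->] xj]].
move=> /andP[/imsetP[l _ ->] xl] [ij jl li].
have three (a b d : 'I_m) : a < b -> b < d -> red x (c a) -> red x (c b) -> red x (c d) -> False.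
  move=> ab bd; apply: (no_three_neighbours xC ab bd).
  by apply: leq_trans (ltn_ord d) (leq_addl _ _).
have [h|h|h] := ltngtP i j; last by rewrite h eqxx in ij.
  have [h'|h'|h'] := ltngtP j l; last by rewrite h' eqxx in jl.
    exact: (three i j l).
  have [h2|h2|h2] := ltngtP i l; last by rewrite h2 eqxx in li.
    exact: (three i l j).
  exact: (three l i j).
have [h'|h'|h'] := ltngtP i l; last by rewrite h' eqxx in li.
  exact: (three j i l).
have [h2|h2|h2] := ltngtP j l; last by rewrite h2 eqxx in jl.
  exact: (three j l i).
exact: (three l j i).
Qed.
End AtMostTwo.

(** * Blue fans off the cycle *)

(** By the theorem of Hall, three sets with at least two elements have distinct
    representatives unless they are one and the same pair. *)
Lemma distinct_choice (T : finType) (S1 S2 S3 : {set T}) :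
  1 < #|S1| -> 1 < #|S2| -> 1 < #|S3| -> 2 < #|S1| \/ ~ (S1 = S2 /\ S2 = S3) ->
  exists s1 s2 s3, [/\ s1 \in S1, s2 \in S2 & s3 \in S3] /\ uniq [:: s1; s2; s3].
Proof.
move=> c1 c2 c3 big.
have other (S : {set T}) s : 1 < #|S| -> exists2 t, t \in S & t != s.
  move=> cS; have [|t tS ts] := @ex_out _ S [set s]; first by rewrite cards1.
  by exists t => //; rewrite inE in ts.
have step (A1 A2 A3 : {set T}) : 1 < #|A2| -> 1 < #|A3| -> ~~ (A1 \subset A2) ->
    exists s1 s2 s3, [/\ s1 \in A1, s2 \in A2 & s3 \in A3] /\ uniq [:: s1; s2; s3].
  move=> cA2 cA3 /subsetPn[s1 S1' s12].
  have [s3 S3' s31] := other A3 s1 cA3; have [s2 S2' s23] := other A2 s3 cA2.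
  have ne : s1 != s2 by apply: contraNneq s12 => ->.
  by exists s1, s2, s3; split=> //; rewrite /= !inE negb_or ne s23 (eq_sym s1 s3) s31.
have [s12|/(step _ _ _ c2 c3)//] := boolP (S1 \subset S2).
have [s23|/(step _ _ _ c3 c1) [s2 [s3 [s1 [[? ? ?] u]]]]] := boolP (S2 \subset S3); last first.
  exists s1, s2, s3; split=> //; move: u; rewrite /= !inE !negb_or => /and3P[/andP[a b] d _].
  by rewrite (eq_sym s1 s2) b (eq_sym s1 s3) d a.
have [s31|/(step _ _ _ c1 c2) [s3 [s1 [s2 [[? ? ?] u]]]]] := boolP (S3 \subset S1); last first.
  exists s1, s2, s3; split=> //; move: u; rewrite /= !inE !negb_or => /and3P[/andP[a b] d _].
  by rewrite d (eq_sym s1 s3) a (eq_sym s2 s3) b.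
have E12 : S1 = S2 by apply/eqP; rewrite eqEsubset s12 (subset_trans s23).
have E23 : S2 = S3 by apply/eqP; rewrite eqEsubset s23 -E12.
case: big => [/card_gt2P[a [b [d [[aS bS dS] [ab bd da]]]]]|[]//].
exists a, b, d; rewrite -E23 -E12; split=> //.
by rewrite /= !inE negb_or ab bd (eq_sym a d) da.
Qed.

Section Fans.
Variables (V : finType) (red : rel V).
Hypotheses (red_sym : symmetric red) (red_irr : irreflexive red).
Variables (m : nat) (c : nat -> V).
Hypotheses (cC : cyclic red m c) (m_gt6 : 6 < m) (cardV : #|V| = m.*2.+1).
Hypotheses (nocycle : no_cycle red m.+1) (nowheel : no_wheel red).
Local Notation carrier := (carrier m c).
Local Notation blue := (blue red).
Local Notation blue_sym := (blue_sym red_sym).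
Local Notation Nc := (red_nbrs red carrier).

(** Otherwise the vertices off the cycle would satisfy the condition of [dirac] and
    carry a red cycle of length [m.+1]. *)
Lemma blue_fan : exists2 h, h \notin carrier & 3 < #|blue_nbrs red (~: carrier) h|.
Proof.
have m_gt2 : 2 < m by lia.
have cardX : #|~: carrier| = m.+1.
  by have := cardsC carrier; rewrite cardV (card_carrier cC m_gt2) -addnn; lia.
have [|nd] := boolP [forall x in ~: carrier, #|~: carrier| <= (#|red_nbrs red (~: carrier) x|).*2].
  move=> /forall_inP dS; have [|s [ss us cs]] := dirac red_sym red_irr _ dS.
    by rewrite cardX; lia.
  by case: (nocycle (s := s)); rewrite // ss.
move: nd; rewrite negb_forall_in => /exists_inP[h hX]; rewrite -ltnNge cardX => lt.
exists h; first by rewrite inE in hX.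
have : #|~: carrier :\ h| <= #|red_nbrs red (~: carrier) h| + #|blue_nbrs red (~: carrier) h|.
  have [le _] := leq_card_setU (red_nbrs red (~: carrier) h) (blue_nbrs red (~: carrier) h).
  apply: leq_trans le; apply/subset_leq_card/subsetP => y /setD1P[yh yX].
  rewrite !in_set -[y \notin carrier]in_setC yX /blue eq_sym yh /=.
  by case: (red h y).
have := cardsD1 h (~: carrier); rewrite hX cardX; clear -m_gt6 lt; lia.
Qed.

(** [y1, s12, y2, s23, y3, s13] is the rim of a wheel with hub [h]. *)
Lemma fan_absurd h y1 y2 y3 s12 s23 s13 :
    [/\ y1 \notin carrier, y2 \notin carrier & y3 \notin carrier] ->
    uniq [:: y1; y2; y3] -> [/\ blue h y1, blue h y2 & blue h y3] ->
    [/\ s12 \in carrier, s23 \in carrier & s13 \in carrier] ->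
    uniq [:: s12; s23; s13] -> [/\ blue h s12, blue h s23 & blue h s13] ->
    [/\ blue y1 s12, blue y2 s12 & blue y2 s23] ->
    [/\ blue y3 s23, blue y3 s13 & blue y1 s13] -> False.
Proof.
move=> [Y1 Y2 Y3] uy [b1 b2 b3] [S12 S23 S13] us [b12 b23 b13] [b112 b212 b223] [b323 b313 b113].
have ne y s : y \notin carrier -> s \in carrier -> y != s.
  by move=> yC sC; apply: contraNneq yC => ->.
have ne' y s : y \notin carrier -> s \in carrier -> s != y.
  by move=> *; rewrite eq_sym ne.
move: uy us; rewrite /= !inE !negb_or => /and3P[/andP[y12 y13] y23 _] /and3P[/andP[s1 s2] s3 _].
apply: (nowheel (h := h) (s := [:: y1; s12; y2; s23; y3; s13])) => //.
- rewrite /= !inE !negb_or y12 y13 y23 s1 s2 s3.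
  rewrite (ne y1 s12) ?(ne y1 s23) ?(ne y1 s13) ?(ne y2 s23) ?(ne y2 s13) ?(ne y3 s13) //.
  by rewrite (ne' y2 s12) ?(ne' y3 s12) ?(ne' y3 s23).
- by rewrite /= b1 b12 b2 b23 b3 b13.
- rewrite /= b112 b223 b313 (blue_sym s12) b212 (blue_sym s23) b323 (blue_sym s13) b113.
  by [].
Qed.

(** The vertices of the cycle that are blue to [h], [y_a] and [y_b] form a set [S]
    of at least [m - 6 >= 2] elements.  If the three sets obtained are equal, they
    have at least three elements. *)
Lemma long_fan_absurd : 7 < m -> False.
Proof.
move=> m7; have m_gt2 : 2 < m by lia.
have few := few_neighbours red_sym red_irr cC m_gt6 cardV nocycle nowheel.
have [h hC /ltnW/card_gt2P[y1 [y2 [y3 []]]]] := blue_fan.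
rewrite !inE => -[/andP[Y1 b1] /andP[Y2 b2] /andP[Y3 b3]] [y12 y23 y31].
pose S a b := carrier :\: (Nc h :|: (Nc a :|: Nc b)).
have subN v : Nc v \subset carrier by apply/subsetP => y; rewrite inE => /andP[].
have cU (A1 A2 : {set V}) k l : #|A1| <= k -> #|A2| <= l -> #|A1 :|: A2| <= k + l.
  by move=> *; have [le _] := leq_card_setU A1 A2; apply: leq_trans le _; apply: leq_add.
have cS a b : a \notin carrier -> b \notin carrier -> m - 6 <= #|S a b|.
  move=> aC bC; rewrite cardsD (card_carrier cC m_gt2); apply: leq_sub => //.
  apply: leq_trans (subset_leq_card (subsetIr _ _)) _.
  by rewrite -[6]/(2 + (2 + 2)); apply: (cU); [|apply: (cU)]; apply: (few).
have SE a b : Nc h :|: (Nc a :|: Nc b) = carrier :\: S a b.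
  rewrite /S setDDr setDv set0U; apply/esym/setIidPr.
    by rewrite !subUset !subN.
have big : 2 < #|S y1 y2| \/ ~ (S y1 y2 = S y2 y3 /\ S y2 y3 = S y1 y3).
  have [E12|] := eqVneq (S y1 y2) (S y2 y3); last by move/eqP=> ne; right=> -[/ne].
  have [E23|] := eqVneq (S y2 y3) (S y1 y3); last by move/eqP=> ne; right=> -[_ /ne].
  left; have R1 := SE y1 y2; have R2 := SE y2 y3; have R3 := SE y1 y3.
  rewrite E12 -R2 in R1; rewrite -E23 -R2 in R3.
  suff le5 : #|Nc h :|: (Nc y2 :|: Nc y3)| <= 5.
    rewrite E12 cardsD (card_carrier cC m_gt2).
    apply: leq_trans (leq_sub2l _ (leq_trans (subset_leq_card (subsetIr _ _)) le5)).
    by clear -m7; lia.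
  (* Each vertex of the common union lies in each of the three pairwise unions,
     which allows Nc y2 and Nc y3 to be traded for Nc y1 and their intersection. *)
  have [I1|I2] := leqP #|Nc y2 :&: Nc y3| 1.
    have sub : Nc h :|: (Nc y2 :|: Nc y3) \subset Nc h :|: (Nc y1 :|: (Nc y2 :&: Nc y3)).
      apply/subsetP => z zR; have := zR; have := zR; rewrite -{1}R1 -R3 !in_setU in_setI.
      by do 4!case: (z \in Nc _).
    apply: leq_trans (subset_leq_card sub) _.
    by rewrite -[5]/(2 + (2 + 1)); apply: (cU); [|apply: (cU)] => //; apply: (few).
  have E2 : Nc y2 :&: Nc y3 = Nc y2.
    by apply/eqP; rewrite eqEcard subsetIl (leq_trans (few _ Y2)).
  have E3 : Nc y2 :&: Nc y3 = Nc y3.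
    by apply/eqP; rewrite eqEcard subsetIr (leq_trans (few _ Y3)).
  by rewrite -{1}E2 E3 setUid; apply: leq_trans (cU _ _ 2 2 _ _) _ => //; apply: (few).
have two a b : a \notin carrier -> b \notin carrier -> 1 < #|S a b|.
  by move=> aC bC; apply: leq_trans (cS a b aC bC); clear -m7; lia.
have [s12 [s23 [s13 [[]]]]] := distinct_choice (two _ _ Y1 Y2) (two _ _ Y2 Y3) (two _ _ Y1 Y3) big.
have blueS v s : v \notin carrier -> s \in carrier -> s \notin Nc v -> blue v s.
  move=> vC sC; rewrite inE sC /= /blue => ->; rewrite andbT.
  by apply: contraNneq vC => ->.
have SP a b s : a \notin carrier -> b \notin carrier -> s \in S a b ->
    [/\ s \in carrier, blue h s, blue a s & blue b s].
  move=> aC bC; rewrite in_setD !in_setU !negb_or => /andP[/and3P[nh na nb] sC].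
  by split=> //; apply: blueS.
move=> /(SP _ _ _ Y1 Y2)[? ? ? ?] /(SP _ _ _ Y2 Y3)[? ? ? ?] /(SP _ _ _ Y1 Y3)[? ? ? ?] us.
apply: (@fan_absurd h y1 y2 y3 s12 s23 s13) => //.
by rewrite /= !inE negb_or y12 y23 (eq_sym y1) y31.
Qed.
End Fans.

(** * Red cycles of length seven, by a finite check *)

(** The possible red neighbourhoods on a heptagon of a vertex off it. *)
Definition sparse (r : mask) := (count id r <= 2) &&
  all (fun i => ~~ (nth false r i && nth false r (i.+1 %% 7))) (iota 0 7).
Definition common_blue (r0 r1 r2 : mask) :=
  [seq k <- iota 0 7 | [&& ~~ nth false r0 k, ~~ nth false r1 k & ~~ nth false r2 k]].
(** The configuration of [fan_absurd] with hub [h] of neighbourhood [r0] and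
    [y1], [y2], [y3] of neighbourhoods [r1], [r2], [r3]. *)
Definition fan_wheel r0 r1 r2 r3 :=
  let c13 := common_blue r0 r1 r3 in
  let c23 := common_blue r0 r2 r3 in
  has (fun a => has (fun b => if a == b then false else
    has (fun d => if d == a then false else d != b) c13) c23) (common_blue r0 r1 r2).

Definition heptagon : graph :=
  mkseq (fun i => mkseq (fun j => (j == i.+1 %% 7) || (i == j.+1 %% 7)) 7) 7.
(** The vertices 0 to 6 are those of the heptagon, 7 is [h], and 8 to 11 are four of
    its blue neighbours.  The chords of the heptagon may have any colour, so they
    appear neither in [red_part] nor in [blue_part]. *)
Definition red_part (rs yy : graph) : graph :=
  [seq nth [::] heptagon i ++ [seq nth false r i | r <- rs] | i <- iota 0 7] ++
  [seq p.1 ++ p.2 | p <- zip rs yy].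
Definition blue_part (rs yy : graph) : graph :=
  [seq nseq 7 false ++ [seq ~~ nth false r i | r <- rs] | i <- iota 0 7] ++
  [seq map negb p.1 ++ p.2 | p <- zip rs yy].
(** A red cycle of length eight, or a blue hexagon in the blue neighbourhood
    of [h]. *)
Definition closed (rs yr yb : graph) :=
  let g := red_part rs yr in
  if has_cycle_in 5 g (nseq 12 true) then true else
  let b := blue_part rs yb in has_cycle_in 3 b (nth [::] b 7).
(** The edges among the last five vertices: [z] for those at [h], [q] for the six
    pairs of its neighbours. *)
Definition star_graph (z : bool) (q : mask) : graph :=
  let f := nth false q in
  [:: [:: false; z; z; z; z]; [:: z; false; f 0; f 1; f 2]; [:: z; f 0; false; f 3; f 4];
      [:: z; f 1; f 3; false; f 5]; [:: z; f 2; f 4; f 5; false]].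
(** Most cases are settled whatever the colours between the four neighbours of [h];
    for the others all colours are tried. *)
Definition settled rs :=
  let none := nseq 6 false in
  if closed rs (star_graph false none) (star_graph true none) then true
  else all (fun q => closed rs (star_graph false q) (star_graph true (map negb q)))
         (all_masks 6).
Definition sparse_rows := [seq r <- all_masks 7 | sparse r].
Definition all_checked (fan : mask -> mask -> mask -> mask -> bool)
    (check : graph -> bool) (l0 l : seq mask) :=
  all (fun r0 => all (fun r1 => all (fun r2 => all (fun r3 =>
    if fan r0 r1 r2 r3 then true else all (fun r4 =>
      if [|| fan r0 r1 r2 r4, fan r0 r1 r3 r4 | fan r0 r2 r3 r4] then true
      else check [:: r0; r1; r2; r3; r4]) l) l) l) l) l0.

Lemma all_checkedP fan check l0 l r0 r1 r2 r3 r4 : all_checked fan check l0 l ->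
  r0 \in l0 -> r1 \in l -> r2 \in l -> r3 \in l -> r4 \in l ->
  ~~ fan r0 r1 r2 r3 -> ~~ fan r0 r1 r2 r4 -> ~~ fan r0 r1 r3 r4 -> ~~ fan r0 r2 r3 r4 ->
  check [:: r0; r1; r2; r3; r4].
Proof.
move=> all_ok l0r l1 l2 l3 l4 /negbTE f3 /negbTE f2 /negbTE f1 /negbTE f0; move: all_ok.
move=> /allP/(_ _ l0r)/allP/(_ _ l1)/allP/(_ _ l2)/allP/(_ _ l3).
by rewrite f3 => /allP/(_ _ l4); rewrite f2 f1 f0.
Qed.

(** Rotating the heptagon, one may assume that the first vertex is red to [h] if any
    is. *)
Definition first_rows := [seq r <- sparse_rows | head false r || ~~ has id r].

Lemma all_sparse_settled : all_checked fan_wheel settled first_rows sparse_rows.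
Proof. by vm_cast_no_check (erefl true). Qed.

Section Seven.
Variables (V : finType) (red : rel V).
Hypotheses (red_sym : symmetric red) (red_irr : irreflexive red).
Variable c : nat -> V.
Hypotheses (cC : cyclic red 7 c) (cardV : #|V| = 15).
Hypotheses (nocycle : no_cycle red 8) (nowheel : no_wheel red).
Local Notation carrier := (carrier 7 c).
Local Notation blue := (blue red).
Local Notation blue_sym := (blue_sym red_sym).
Definition row7 v : mask := [seq red v (c i) | i <- iota 0 7].

Let cR i : red (c i) (c i.+1). Proof. by case: cC. Qed.
Let cI i j : i < 7 -> j < 7 -> c i = c j -> i = j.
Proof. by move=> i7 j7; case: cC => _ _ inj; apply: (inj 0). Qed.
Let cmod i : c (i %% 7) = c i.
Proof. exact: cyclic_modn cC. Qed.
Let carrier_c i : c i \in carrier. Proof. exact: (mem_carrier cC isT). Qed.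

Lemma nth_row7 v i : nth false (row7 v) i = (i < 7) && red v (c i).
Proof.
have [i7|i7] := ltnP i 7; first by rewrite (nth_map 0) ?size_iota // nth_iota.
by rewrite nth_default // size_map size_iota.
Qed.

Lemma sparse_row7 v : v \notin carrier -> row7 v \in sparse_rows.
Proof.
move=> vC; rewrite mem_filter -[7](size_iota 0) -(size_map (fun i => red v (c i))).
rewrite mem_all_masks andbT; apply/andP; split.
  rewrite count_map -size_filter -(size_map c).
  have u : uniq [seq c i | i <- [seq i <- iota 0 7 | preim (fun i => red v (c i)) id i]].
    rewrite map_inj_in_uniq ?filter_uniq ?iota_uniq // => i j.
    by rewrite !mem_filter !mem_iota => /andP[_ i7] /andP[_ j7]; apply: cI.
  rewrite -(card_uniqP u).
  apply: leq_trans (few_neighbours red_sym red_irr cC _ cardV nocycle nowheel vC) => //.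
  apply/subset_leq_card/subsetP => y /mapP[i]; rewrite mem_filter => /andP[/= vi _] ->.
  by rewrite inE carrier_c.
apply/allP => i _; rewrite !nth_row7 cmod; apply/negP => /andP[/andP[_ vi] /andP[_ vi']].
by have := no_consecutive red_sym cC isT nocycle vC vi; rewrite vi'.
Qed.

Lemma fan_wheel_absurd h y1 y2 y3 :
    [/\ y1 \notin carrier, y2 \notin carrier & y3 \notin carrier] -> h \notin carrier ->
    uniq [:: y1; y2; y3] -> [/\ blue h y1, blue h y2 & blue h y3] ->
  ~~ fan_wheel (row7 h) (row7 y1) (row7 y2) (row7 y3).
Proof.
move=> [Y1 Y2 Y3] hC uy bh; have ne y s : y \notin carrier -> y != c s.
  by move=> yC; apply: contraNneq yC => ->.
have common a b k : a \notin carrier -> b \notin carrier ->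
    k \in common_blue (row7 h) (row7 a) (row7 b) ->
    [/\ k < 7, blue h (c k), blue a (c k) & blue b (c k)].
  move=> aC bC; rewrite mem_filter mem_iota add0n !nth_row7 => /andP[+ /andP[_ k7]].
  by rewrite k7 => /and3P[nh na nb]; split; rewrite // /blue ?ne.
apply/negP => /hasP[a /(common _ _ _ Y1 Y2)[a7 ha a1 a2]].
case/hasP=> b /(common _ _ _ Y2 Y3)[b7 hb b2 b3]; case: eqVneq => // ab.
case/hasP=> d /(common _ _ _ Y1 Y3)[d7 hd d1 d3]; case: eqVneq => // da db.
have cne i j : i < 7 -> j < 7 -> i != j -> c i != c j.
  by move=> i7 j7; apply: contra => /eqP/(cI i7 j7)->.
apply: (fan_absurd red_sym nowheel (h := h) (y1 := y1) (y2 := y2) (y3 := y3)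
  (c := c) (m := 7) (s12 := c a) (s23 := c b) (s13 := c d)) => //.
by rewrite /= !inE negb_or !cne // eq_sym.
Qed.

Section Outside.
Variables (h y1 y2 y3 y4 : V).
Let outs := [:: h; y1; y2; y3; y4].
Hypotheses (outC : forall v, v \in outs -> v \notin carrier) (uouts : uniq outs).
Let rs := map row7 outs.
Let s := [seq c i | i <- iota 0 7] ++ outs.
Let nth_s i : nth h s i = if i < 7 then c i else nth h outs (i - 7).
Proof.
rewrite nth_cat size_map size_iota; case: ltnP => // i7.
by rewrite (nth_map 0) ?size_iota // nth_iota.
Qed.

Let outs_c v i : v \in outs -> v != c i.
Proof. by move=> /outC vC; apply: contraNneq vC => ->. Qed.

Lemma red_part_edge yr i j : size yr = 5 ->
  (forall a b, edge yr a b -> red (nth h outs a) (nth h outs b)) ->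
  edge (red_part rs yr) i j -> red (nth h s i) (nth h s j).
Proof.
move=> s5 hyr; rewrite /edge /red_part nth_cat size_map size_iota !nth_s.
case: (ltnP i 7) => i7.
  rewrite (nth_map 0) ?size_iota // nth_iota // add0n nth_mkseq // nth_cat size_mkseq.
  case: (ltnP j 7) => j7.
    by rewrite nth_mkseq // => /orP[] /eqP->; rewrite cmod // red_sym.
  rewrite -map_comp; have [j5|j5] := ltnP (j - 7) 5; last by rewrite nth_default.
  by rewrite (nth_map h) //= nth_row7 i7 red_sym.
have [i5|i5] := ltnP (i - 7) 5; last first.
  by rewrite [nth [::] _ _]nth_default ?nth_nil // size_map size_zip s5.
rewrite (nth_map ([::], [::])) ?size_zip ?s5 // nth_zip ?s5 //= nth_cat.
rewrite (nth_map h) // size_map size_iota; case: (ltnP j 7) => j7.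
  by rewrite nth_row7 j7.
exact: hyr.
Qed.

Lemma blue_part_edge yb i j : size yb = 5 ->
  (forall a b, edge yb a b -> blue (nth h outs a) (nth h outs b)) ->
  edge (blue_part rs yb) i j -> blue (nth h s i) (nth h s j).
Proof.
move=> s5 hyb; rewrite /edge /blue_part nth_cat size_map size_iota !nth_s.
case: (ltnP i 7) => i7.
  rewrite (nth_map 0) ?size_iota // nth_iota // add0n nth_cat size_nseq.
  case: (ltnP j 7) => j7; first by rewrite nth_nseq if_same.
  rewrite -map_comp; have [j5|j5] := ltnP (j - 7) 5; last by rewrite nth_default.
  rewrite (nth_map h) //= nth_row7 i7 blue_sym /blue => ->.
  by rewrite outs_c // mem_nth.
have [i5|i5] := ltnP (i - 7) 5; last first.
  by rewrite [nth [::] _ _]nth_default ?nth_nil // size_map size_zip s5.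
rewrite (nth_map ([::], [::])) ?size_zip ?s5 // nth_zip ?s5 //= nth_cat.
rewrite (nth_map h) // !size_map size_iota; case: (ltnP j 7) => j7.
  rewrite (nth_map false) ?size_map ?size_iota // nth_row7 j7 /blue => ->.
  by rewrite outs_c // mem_nth.
exact: hyb.
Qed.

Lemma closed_absurd qr qb :
  (forall a b, edge (star_graph false qr) a b -> red (nth h outs a) (nth h outs b)) ->
  (forall a b, edge (star_graph true qb) a b -> blue (nth h outs a) (nth h outs b)) ->
  ~~ closed rs (star_graph false qr) (star_graph true qb).
Proof.
move=> hr hb.
have er i j := @red_part_edge (star_graph false qr) i j erefl hr.
have eb i j := @blue_part_edge (star_graph true qb) i j erefl hb.
have us : uniq s.
  rewrite cat_uniq uouts andbT map_inj_in_uniq ?iota_uniq ?andTb; last first.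
    by move=> i j; rewrite !mem_iota => i7 j7; apply: cI; lia.
  apply/hasPn => v /outC; apply: contra => /mapP[i _ ->]; exact: carrier_c.
have ss : size s = 12 by [].
rewrite /closed; case: ifP => [|_].
  case/has_cycle_inP => [i|z [q [sq uq aq pq lq]]].
    by apply/negP => /er; rewrite red_irr.
  have qs : {in z :: q, forall i, i < size s}.
    by move=> i /(allP aq) /nth_true; rewrite size_nseq.
  case: (nocycle (s := map (nth h s) (z :: q))).
  - by rewrite size_map /= sq.
  - exact: uniq_nth.
  rewrite /= rcons_path last_map (red_sym _ (nth h s z)) er // andbT.
  by apply: homo_path pq => i j /er.
apply/negP; case/has_cycle_inP => [i|z [q [sq uq aq pq lq]]].
  by apply/negP => /eb; rewrite /blue eqxx.
have hs : nth h s 7 = h by [].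
have bq i : i \in z :: q -> i < size s /\ blue h (nth h s i).
  move=> /(allP aq) hi; split; last by rewrite -[X in blue X _]hs; apply: eb.
  by have := nth_true hi; rewrite size_cat !size_map size_iota.
have qs : {in z :: q, forall i, i < size s} by move=> i /bq[].
case: (nowheel (h := h) (s := map (nth h s) (z :: q))).
- by rewrite size_map /= sq.
- exact: uniq_nth.
- by rewrite all_map; apply/allP => i /bq[].
rewrite /= rcons_path last_map blue_sym eb // andbT.
by apply: homo_path pq => i j /eb.
Qed.
End Outside.

Lemma seven_fan_absurd h y1 y2 y3 y4 : uniq [:: h; y1; y2; y3; y4] ->
  (forall v, v \in [:: h; y1; y2; y3; y4] -> v \notin carrier) ->
  [/\ blue h y1, blue h y2, blue h y3 & blue h y4] ->
  head false (row7 h) || ~~ has id (row7 h) -> False.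
Proof.
move=> u outC [b1 b2 b3 b4] start.
have [Ch C1 C2 C3 C4] : [/\ h \notin carrier, y1 \notin carrier, y2 \notin carrier,
    y3 \notin carrier & y4 \notin carrier].
  by split; apply: outC; rewrite !inE eqxx ?orbT.
have := u; rewrite /= !inE !negb_or -!andbA.
case/and5P=> h1 h2 h3 h4 /and5P[n12 n13 n14 n23 /and3P[n24 n34 _]].
have H0 : row7 h \in first_rows.
  by rewrite mem_filter; apply/andP; split; [exact: start | exact: sparse_row7].
have := all_checkedP all_sparse_settled H0 (sparse_row7 C1) (sparse_row7 C2)
  (sparse_row7 C3) (sparse_row7 C4).
have fan a b d : [/\ a \notin carrier, b \notin carrier & d \notin carrier] ->
    [&& a != b, a != d & b != d] -> [/\ blue h a, blue h b & blue h d] ->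
    ~~ fan_wheel (row7 h) (row7 a) (row7 b) (row7 d).
  move=> aC /and3P[ab ad bd] ha; apply: fan_wheel_absurd => //.
  by rewrite /= !inE negb_or ab ad bd.
have star (R : rel V) (z : bool) q : symmetric R ->
    (z -> [/\ R h y1, R h y2, R h y3 & R h y4]) ->
    [/\ nth false q 0 -> R y1 y2, nth false q 1 -> R y1 y3 & nth false q 2 -> R y1 y4] ->
    [/\ nth false q 3 -> R y2 y3, nth false q 4 -> R y2 y4 & nth false q 5 -> R y3 y4] ->
    forall a b, edge (star_graph z q) a b ->
      R (nth h [:: h; y1; y2; y3; y4] a) (nth h [:: h; y1; y2; y3; y4] b).
  move=> Rs hz [r0 r1 r2] [r3 r4 r5] a b; rewrite /edge /star_graph.
  case: a => [|[|[|[|[|a]]]]]; case: b => [|[|[|[|[|b]]]]] //=; rewrite ?nth_nil // => e;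
    by [case: (hz e) | rewrite Rs; case: (hz e) | exact: r0 | exact: r1 | exact: r2
      | exact: r3 | exact: r4 | exact: r5 | rewrite Rs; exact: r0 | rewrite Rs; exact: r1
      | rewrite Rs; exact: r2 | rewrite Rs; exact: r3 | rewrite Rs; exact: r4
      | rewrite Rs; exact: r5].
have closedN := closed_absurd outC u => st.
have {st} : settled [:: row7 h; row7 y1; row7 y2; row7 y3; row7 y4].
  by apply: st; apply: fan; rewrite ?n12 ?n13 ?n14 ?n23 ?n24 ?n34.
rewrite /settled; case: ifP => [cl _|_ /allP al].
  apply/negP: cl; apply: closedN; apply: star => //; exact: blue_sym.
pose q := [:: red y1 y2; red y1 y3; red y1 y4; red y2 y3; red y2 y4; red y3 y4].
have := al q (mem_all_masks q); apply/negP; apply: closedN; apply: star => //.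
  exact: blue_sym.
by split; rewrite /= /blue ?n12 ?n13 ?n14 ?n23 ?n24 ?n34.
by split; rewrite /= /blue ?n12 ?n13 ?n14 ?n23 ?n24 ?n34.
Qed.
End Seven.

Section SevenCycle.
Variables (V : finType) (red : rel V).
Hypotheses (red_sym : symmetric red) (red_irr : irreflexive red).

Lemma seven_cycle_absurd c : cyclic red 7 c -> #|V| = 15 ->
  no_cycle red 8 -> no_wheel red -> False.
Proof.
move=> cC cardV nocycle nowheel.
have [h hC] := blue_fan red_sym red_irr cC isT cardV nocycle.
case/card_geqP => ys [uys sys subys].
case: ys sys uys subys => [|y1 [|y2 [|y3 [|y4 [|]]]]] // _ uys subys.
have ysP y : y \in [:: y1; y2; y3; y4] -> y \notin carrier 7 c /\ blue red h y.
  by move/subys; rewrite !inE => /andP[].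
(* The first red neighbour of h becomes vertex 0; the remainder turns the default
   index 7 into 0. *)
pose k := find (red h \o c) (iota 0 7) %% 7.
have cC' := cyclic_shift k cC.
have sub v : v \notin carrier 7 c -> v \notin carrier 7 (fun i => c (i + k)).
  by apply: contra => /imsetP[i _ ->]; apply: (mem_carrier cC).
have bys y : y \in [:: y1; y2; y3; y4] -> blue red h y by case/ysP.
apply: (seven_fan_absurd red_sym red_irr cC' cardV nocycle nowheel (h := h)
  (y1 := y1) (y2 := y2) (y3 := y3) (y4 := y4)).
- rewrite cons_uniq uys andbT; apply/negP => /ysP[_].
  by rewrite /blue eqxx.
- by move=> v; rewrite inE => /predU1P[->|/ysP[vC _]]; apply: sub.
- by split; apply: bys; rewrite !inE eqxx ?orbT.
rewrite /k; case: (boolP (has (red h \o c) (iota 0 7))) => [hk|nk].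
  have := nth_find 0 hk; rewrite nth_iota -?[X in _ < X](size_iota 0 7) -?has_find //.
  have := hk; rewrite has_find size_iota => k7.
  by rewrite /= add0n modn_small // => ->.
apply/orP; right; apply: contra nk => /hasP[b /mapP[i _ ->] hi]; apply/hasP.
exists ((i + k) %% 7); first by rewrite mem_iota ltn_pmod.
by rewrite /= (cyclic_modn _ cC).
Qed.
End SevenCycle.

(** * The upper bound *)

Lemma no_cycle_sub (V : finType) (red : rel V) (S : {set V}) n :
  no_cycle red n -> no_cycle (relpre (val : {x | x \in S} -> V) red) n.
Proof.
move=> nocycle [|x s] ss us cs.
  by apply: (nocycle [::]).
apply: (nocycle (map val (x :: s))); first by rewrite size_map.
  by rewrite map_inj_uniq //; exact: val_inj.
by move: cs; rewrite /= -map_rcons path_map.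
Qed.

Lemma no_wheel_sub (V : finType) (red : rel V) (S : {set V}) :
  no_wheel red -> no_wheel (relpre (val : {x | x \in S} -> V) red).
Proof.
move=> nowheel h [|x s] // ss us bh cs.
apply: (nowheel (val h) (map val (x :: s))); first by rewrite size_map.
- by rewrite map_inj_uniq //; exact: val_inj.
- by rewrite all_map.
by move: cs; rewrite [X in _ -> X]/= -map_rcons path_map.
Qed.

Lemma no_cycleP (V : finType) (red : rel V) n :
  reflect (no_cycle red n) (~~ [exists t : n.-tuple V, uniq t && cycle red t]).
Proof.
apply: (iffP existsPn) => [nt s ss us cs|nocycle t].
  by have := nt (Tuple (introT eqP ss)); rewrite us cs.
by apply/negP => /andP[ut]; apply: nocycle; rewrite ?size_tuple.
Qed.

(** Induction on [n]; the sharp number of vertices is restored by passing to a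
    subset. *)
Lemma upper_bound (V : finType) (red : rel V) n : symmetric red -> irreflexive red ->
  5 < n -> n.*2.-1 <= #|V| -> no_cycle red n -> no_wheel red -> False.
Proof.
elim: n V red => // m IH V red red_sym red_irr; rewrite ltnS leq_eqVlt.
case/predU1P => [<-|m_gt5] card_ge nocycle nowheel.
  exact: (ramsey6 red_sym red_irr).
have [S _ cardS] : exists2 S : {set V}, S \subset setT & #|S| = m.*2.+1.
  by have /card_geqP[s [us ss _]] : m.*2.+1 <= #|V| by [];
    exists [set x in s]; rewrite ?subsetT // cardsE (card_uniqP us).
have cardV' : #|{: {x | x \in S}}| = m.*2.+1 by rewrite card_sig -cardS; apply: eq_card.
have nocycle' := @no_cycle_sub _ _ S _ nocycle; have nowheel' := @no_wheel_sub _ _ S nowheel.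
set red' := relpre _ red in nocycle' nowheel'.
have sym' : symmetric red' by move=> x y; apply: red_sym.
have irr' : irreflexive red' by move=> x; apply: red_irr.
case: (boolP [exists t : m.-tuple _, uniq t && cycle red' t]) => [|/no_cycleP nocyclem].
  case/existsP => t /andP[ut ct]; have st := size_tuple t.
  move: m_gt5; rewrite leq_eqVlt => /predU1P[m6|m_gt6].
    by subst m; apply: (ramsey7 sym' irr' _ st ut ct) => //; rewrite cardV'.
  case: (tval t) st ut ct => [st|x0 s st ut ct]; first by rewrite -st in m_gt6.
  have := cyclic_nth x0 ut ct isT; rewrite st => {st} cC.
  move: (m_gt6); rewrite leq_eqVlt => /predU1P[m7|m_gt7].
    by subst m; exact: (seven_cycle_absurd sym' irr' cC).
  exact: (long_fan_absurd sym' irr' cC).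
by apply: (IH _ red' sym' irr') => //; rewrite cardV'; lia.
Qed.

(** * Copies of cycles and wheels *)

Lemma cycle_homo (G : sgraph) n (c : nat -> G) : cyclic (@adj G) n c ->
  injective (fun i : 'I_n => c i) /\
  forall x y : 'I_n, cycle_adj x y -> adj (c x) (c y).
Proof.
move=> cC; case: (cC) => _ adj_c inj; split=> [i j|x y].
  by move/(inj 0) => ij; apply/val_inj/ij; rewrite add0n ltn_ord.
by case/andP=> _ /orP[] /eqP-> /=; rewrite (cyclic_modn _ cC) // adj_sym.
Qed.

Lemma cycle_copy (G : sgraph) (s : seq G) :
  0 < size s -> uniq s -> cycle (@adj G) s -> contains_copy G (cycle_graph (size s)).
Proof.
case: s => // x0 s s0 us cs; have [inj hom] := cycle_homo (cyclic_nth x0 us cs s0).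
by exists (fun i : 'I_(size (x0 :: s)) => nth x0 (x0 :: s) (i %% size (x0 :: s))).
Qed.

Lemma wheel_copy (G : sgraph) h (s : seq G) : 0 < size s -> uniq s -> all (adj h) s ->
  cycle (@adj G) s -> contains_copy G (wheel_graph (size s).+1).
Proof.
case: s => // x0 s s0 us /allP hs cs.
have [inj hom] := cycle_homo (cyclic_nth x0 us cs s0).
have spoke (i : 'I_(size (x0 :: s))) : adj h (nth x0 (x0 :: s) (i %% size (x0 :: s))).
  by apply: hs; rewrite mem_nth ?ltn_pmod.
pose f (v : 'I_1 + 'I_(size (x0 :: s))) :=
  if v is inr i then nth x0 (x0 :: s) (i %% size (x0 :: s)) else h.
exists f; split=> [[u|i] [v|j]|[u|i] [v|j]] /=.
- by rewrite !ord1.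
- by move=> e; have := spoke j; rewrite -e adj_irrefl.
- by move=> e; have := spoke i; rewrite e adj_irrefl.
- by move/inj->.
- by rewrite /complete_adj !ord1 eqxx.
- by move=> _; apply: spoke.
- by move=> _; rewrite adj_sym; apply: spoke.
exact: hom.
Qed.

Lemma blue_color_adj N (c : {set 'I_N} -> bool) :
  blue (color_adj c true) =2 color_adj c false.
Proof. by move=> x y; rewrite /blue /color_adj; case: eqVneq => //= _; case: (c _). Qed.

Lemma arrows_cycle_wheel n : 5 < n ->
  arrows n.*2.-1 (cycle_graph n) (wheel_graph 7).
Proof.
move=> n_gt5 c; set red := color_adj c true.
case: (boolP [exists t : n.-tuple _, uniq t && cycle red t]) => [|/no_cycleP nocycle].
  case/existsP=> t /andP[ut ct]; left.
  by have := @cycle_copy (red_graph c) t; rewrite size_tuple; apply=> //; lia.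
have blueE := blue_color_adj c.
case: (boolP [exists h, exists t : 6.-tuple 'I_n.*2.-1,
    [&& uniq t, all (blue red h) t & cycle (blue red) t]]).
  case/existsP=> h /existsP[t /and3P[ut ht ct]]; right.
  have := @wheel_copy (blue_graph c) h t; rewrite size_tuple; apply=> //.
    by rewrite -(eq_all (blueE h)).
  by rewrite -(eq_cycle blueE).
move/existsPn=> nt; case: (@upper_bound _ red n) => //; first exact: color_sym.
- exact: color_irrefl.
- by rewrite card_ord.
move=> h s ss us hs cs; have /existsPn/(_ (Tuple (introT eqP ss))) := nt h.
by rewrite us hs cs.
Qed.

(** * The lower bound *)

Section LowerBound.
Variables (n M : nat).
Hypotheses (n_gt0 : 0 < n) (M_lt : M <= n.-1.*2).

Let side (x : 'I_M) := x < n.-1.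
(** The colour of a pair must be read off the set of its two vertices: red means
    that they lie on the same side of [n - 1]. *)
Definition two_cliques (S : {set 'I_M}) :=
  [forall x in S, forall y in S, side x == side y].

Lemma two_cliques_edge x y : two_cliques [set x; y] = (side x == side y).
Proof.
apply/forall_inP/idP => [/(_ x) |/eqP xy z]; rewrite !inE ?eqxx.
  by move=> /(_ isT)/forall_inP/(_ y); apply; rewrite !inE eqxx orbT.
by case/orP=> /eqP->; apply/forall_inP => t; rewrite !inE => /orP[] /eqP->; rewrite ?xy.
Qed.

(** Adjacent vertices are on the same side, so the whole cycle is on one side, which
    has at most [n - 1] vertices. *)
Lemma no_red_cycle : ~ contains_copy (red_graph two_cliques) (cycle_graph n).
Proof.
case=> f [f_inj f_adj]; pose z : 'I_n := Ordinal n_gt0.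
have same k (kn : k < n) : side (f (Ordinal kn)) = side (f z).
  elim: k kn => [|k IH] kn; first by congr (side (f _)); apply: val_inj.
  rewrite -(IH (ltnW kn)); have := f_adj (Ordinal kn) (Ordinal (ltnW kn)).
  rewrite /= /cycle_adj /color_adj two_cliques_edge eqb_id.
  have -> : (Ordinal kn == Ordinal (ltnW kn)) = false by apply/eqP => -[] /eqP; rewrite eqn_leq ltnn.
  have -> : Ordinal kn == ordS (Ordinal (ltnW kn)).
    by rewrite -val_eqE /= modn_small.
  by rewrite orbT => /(_ isT)/andP[_ /eqP].
(* The side of the cycle is the interval of length n.-1 that starts at d. *)
pose d := if side (f z) then 0 else n.-1.
have fd i : d <= f i < d + n.-1.
  case: i => k kn; have := same k kn; have := ltn_ord (f (Ordinal kn)).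
  rewrite /d /side; case: (ltnP (f z)) => _; lia.
have lt i : f i - d < n.-1 by have := fd i; lia.
have : injective (fun i => Ordinal (lt i)).
  move=> i j [] e; apply/f_inj/ord_inj; case/andP: (fd i) (fd j) => di _ /andP[dj _].
  by rewrite -(subnK di) e subnK.
by move/leq_card; rewrite !card_ord leqNgt ltn_predL n_gt0.
Qed.

(** The hub and two consecutive vertices of the rim would be on pairwise
    different sides. *)
Lemma no_blue_wheel s : 3 < s ->
  ~ contains_copy (blue_graph two_cliques) (wheel_graph s).
Proof.
case: s => [|[|[|[|s]]]] // _ [f [_ f_adj]].
have opp x y : adj x y -> side (f x) != side (f y).
  by move/f_adj; rewrite /= /color_adj two_cliques_edge eqbF_neg => /andP[].
have := opp (inl ord0) (inr ord0) isT; have := opp (inl ord0) (inr (ordS ord0)) isT.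
have := opp (inr ord0) (inr (ordS ord0)).
rewrite /= /cycle_adj eqxx andbT => /(_ isT).
by case: (side (f (inl _))); case: (side (f (inr ord0))); case: (side (f (inr _))).
Qed.
End LowerBound.

Theorem corollary1p4 (n : nat) (hn : 6 <= n) :
  is_ramsey_number (cycle_graph n) (wheel_graph 7) (2 * n - 1).
Proof.
split=> [|M arr]; first by rewrite mul2n subn1; apply: arrows_cycle_wheel.
rewrite leqNgt; apply/negP => M_lt.
have n_gt0 : 0 < n by lia.
have M_le : M <= n.-1.*2 by lia.
case: (arr (two_cliques n (M := M))); first exact: no_red_cycle.
exact: no_blue_wheel.
Qed.
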